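(* The problem Balanced Cluster Completion (BCC), parameterized by $k$, admits a kernel with at most $10k$ vertices: there is a polynomial-time algorithm that, given an instance $(G,k,\eta)$ of BCC, outputs an instance $(G',k',\eta')$ of BCC with $|V(G')|\le 10k$ and $k'\le k$ that is a yes-instance if and only if $(G,k,\eta)$ is a yes-instance.
   Context: All graphs are finite and simple. A cluster graph is a graph in which every connected component is a clique. For a non-negative integer $\eta$, a graph is $\eta$-balanced if for any two connected components $H,H'$ we have $\big||V(H)|-|V(H')|\big|\le\eta$. For $F\subseteq\binom{V(G)}{2}\setminus E(G)$, $G+F$ is the graph with vertex set $V(G)$ and edge set $E(G)\cup F$. Balanced Cluster Completion (BCC): given a cluster graph $G$ and non-negative integers $k,\eta$, decide whether there is $F\subseteq\binom{V(G)}{2}\setminus E(G)$ with $|F|\le k$ such that $G+F$ is an $\eta$-balanced cluster graph.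
   Formalization: For no-instances with k = 0 the bound |V(G')| ≤ 10k cannot hold (the empty graph is a yes-instance; e.g. K1+K2, η = 0 is a no-instance), so for these, and only these, G' may have up to 3 vertices. *)

(* Defs.v *)
From HB Require Import structures.
From mathcomp Require Import all_boot all_order all_algebra.

Set Implicit Arguments.
Unset Strict Implicit.
Unset Printing Implicit Defensive.

(* A finite simple graph on V is a symmetric irreflexive relation on V. *)
Section Graphs.
Variable V : finType.
Implicit Types (e : rel V) (A : {set V}) (F : {set {set V}}).

Definition simple_graph e : Prop := symmetric e /\ irreflexive e.

Definition component e (x : V) : {set V} := [set y | connect e x y].

Definition components e : {set {set V}} := [set component e x | x : V].

Definition is_clique e A : Prop :=
  {in A &, forall x y, x != y -> e x y}.

Definition cluster_graph e : Prop :=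
  forall H, H \in components e -> is_clique e H.

Definition balanced (eta : nat) e : Prop :=
  forall H H', H \in components e -> H' \in components e ->
    (absz (Posz #|H| - Posz #|H'|)%R <= eta)%N.

Definition vertex_pairs : {set {set V}} := [set p : {set V} | #|p| == 2].

Definition edges e : {set {set V}} :=
  [set p : {set V} | [exists x, exists y, e x y && (p == [set x; y])]].

(* Only used for F \subset vertex_pairs, so no loops are created. *)
Definition add_edges e F : rel V :=
  fun x y => e x y || ([set x; y] \in F).

End Graphs.

Record bcc_instance := BCCInstance {
  nvert : nat;
  graph : rel 'I_nvert;
  budget : nat;
  slack : nat;
  graph_simple : simple_graph graph;
  graph_cluster : cluster_graph graph
}.

Definition bcc_yes (I : bcc_instance) : Prop :=
  exists F : {set {set 'I_(nvert I)}},
    [/\ F \subset vertex_pairs _ :\: edges (@graph I),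
        #|F| <= budget I,
        cluster_graph (add_edges (@graph I) F) &
        balanced (slack I) (add_edges (@graph I) F)].

(* Model of computation: a random access machine under the logarithmic cost
   criterion, with structured control flow.  A program uses finitely many
   registers and an unbounded memory, all holding natural numbers; memory is
   accessed only by indirect addressing, and the arithmetic operations are
   addition and truncated subtraction.  Every executed instruction is charged
   the total binary length of the numbers it handles. *)
Inductive cmd : Type :=
| CSkip
| CConst of nat & nat         (* CConst r n : r := n             *)
| CAdd of nat & nat & nat     (* CAdd r a b : r := a + b         *)
| CSub of nat & nat & nat     (* CSub r a b : r := max(a - b, 0) *)
| CLoad of nat & nat          (* CLoad r a  : r := cells[a]      *)
| CStore of nat & nat         (* CStore a r : cells[a] := r      *)
| CSeq of cmd & cmd
| CIf of nat & cmd & cmd      (* tests whether a register is nonzero *)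
| CWhile of nat & cmd.

Record state := State { regs : nat -> nat; cells : nat -> nat }.

Definition upd (f : nat -> nat) (a v : nat) : nat -> nat :=
  fun b => if b == a then v else f b.

Definition set_reg (s : state) (r v : nat) := State (upd (regs s) r v) (cells s).
Definition set_cell (s : state) (a v : nat) := State (regs s) (upd (cells s) a v).

(* Number of binary digits, with bitlen 0 = 1. *)
Definition bitlen (n : nat) : nat := (trunc_log 2 n).+1.

(* exec p s t s' : started in s, program p halts in s' at total cost t. *)
Inductive exec : cmd -> state -> nat -> state -> Prop :=
| exec_Skip s : exec CSkip s 1 s
| exec_Const s r n : exec (CConst r n) s (bitlen n) (set_reg s r n)
| exec_Add s r a b :
    exec (CAdd r a b) s
      (bitlen (regs s a) + bitlen (regs s b) + bitlen (regs s a + regs s b))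
      (set_reg s r (regs s a + regs s b))
| exec_Sub s r a b :
    exec (CSub r a b) s
      (bitlen (regs s a) + bitlen (regs s b) + bitlen (regs s a - regs s b))
      (set_reg s r (regs s a - regs s b))
| exec_Load s r a :
    exec (CLoad r a) s
      (bitlen (regs s a) + bitlen (cells s (regs s a)))
      (set_reg s r (cells s (regs s a)))
| exec_Store s a r :
    exec (CStore a r) s
      (bitlen (regs s a) + bitlen (regs s r))
      (set_cell s (regs s a) (regs s r))
| exec_Seq p q s t s' t' s'' :
    exec p s t s' -> exec q s' t' s'' -> exec (CSeq p q) s (t + t') s''
| exec_IfTrue r p q s t s' :
    regs s r != 0 -> exec p s t s' ->
    exec (CIf r p q) s (bitlen (regs s r) + t) s'
| exec_IfFalse r p q s t s' :
    regs s r = 0 -> exec q s t s' ->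
    exec (CIf r p q) s (bitlen (regs s r) + t) s'
| exec_WhileTrue r p s t s' t' s'' :
    regs s r != 0 -> exec p s t s' -> exec (CWhile r p) s' t' s'' ->
    exec (CWhile r p) s (bitlen (regs s r) + t + t') s''
| exec_WhileFalse r p s :
    regs s r = 0 -> exec (CWhile r p) s (bitlen (regs s r)) s.

(* Words are written to memory from address 0; everything else is 0. *)
Definition init_state (w : seq nat) : state :=
  State (fun=> 0) (fun i => nth 0 w i).

Definition bitsize (w : seq nat) : nat := \sum_(x <- w) bitlen x.

(* The output is read off memory from address 0.  Its bit size is counted as
   part of the running time, because cells that were never written to may
   belong to the output. *)
Definition computes_within (p : cmd) (inp out : seq nat) (T : nat) : Prop :=
  exists (t : nat) (s : state),
    [/\ exec p (init_state inp) t s,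
        forall i, i < size out -> cells s i = nth 0 out i &
        t + bitsize out <= T].

(* f is computable, through the encodings, in time polynomial in the bit size
   of the encoded input.  The encodings should be self-delimiting. *)
Definition polytime (A B : Type) (encA : A -> seq nat) (encB : B -> seq nat)
    (f : A -> B) : Prop :=
  exists (p : cmd) (c d : nat), forall x : A,
    computes_within p (encA x) (encB (f x)) (c * bitsize (encA x) ^ d + c).

(* The three numbers (in binary, as far as bitsize is concerned), then the
   adjacency matrix row by row. *)
Definition encode_bcc (I : bcc_instance) : seq nat :=
  [:: nvert I; budget I; slack I] ++
  [seq nat_of_bool (@graph I x y) | x <- enum 'I_(nvert I),
                                    y <- enum 'I_(nvert I)].

(* Main.v *)
Require Import Defs.
From HB Require Import structures.
From mathcomp Require Import all_boot all_order all_algebra.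
From mathcomp Require Import zify.

Set Implicit Arguments.
Unset Strict Implicit.
Unset Printing Implicit Defensive.

(* A solution merges cliques into groups.  Every vertex of a group with at least
   two cliques gains a neighbour, so at most 2k vertices lie in such groups.
   Exchanging a merged clique with a smaller unmerged one keeps a solution a
   solution, so the merged cliques may be assumed to form an initial segment, of
   total size at most 2k, of the cliques sorted by size.  Beyond the longest such
   segment only the smallest and the largest clique matter, and if the largest
   clique has more than 2k vertices it dominates every group, so that it can be
   shrunk to 2k vertices while eta is decreased by the same amount.  This leaves
   at most 6k vertices.  The program computes, for each vertex, a key that orders
   the cliques by size, decides which vertices to keep, and compacts the adjacency
   matrix in place. *)

(** * Bounded-loop programs and their running time *)

(** Edge sets are traded for labellings: a solution is a labelling constant on the original cliques,
    and its cost is the growth of a sum of squared group sizes. Counting ordered pairs doubles the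
    budget, so the working constant is [k2 = 2k], and the exchange becomes an inequality between
    squares. The bound [6k = 3 * k2] arises when every clique has at most [k2] vertices: the merged
    segment together with the clique that follows it takes at most [k2] plus one clique, and the
    largest clique comes on top. In the shrinking case [2 * k2] vertices suffice. Shrinking loses
    the sizes of the dropped cliques, so hopeless instances must be recognised beforehand. Neither
    the largest clique nor any clique beyond the segment is merged in a normalised solution. Hence a
    clique trailing the largest by more than [eta] has to lie in the segment and be lifted by a
    group of at most [k2] vertices; where this is impossible, a fixed no-instance on three vertices
    is returned. The budget and the slack may be exponential in the input length, so only the number
    of vertices bounds loops; for [n <= 2k] the input itself is the output. *)

Definition bounded (b : nat) (s : state) : Prop :=
  (forall r, regs s r <= 2 ^ b) /\ (forall a, cells s a <= 2 ^ b).

(* [t] counts instructions.  One instruction at most doubles the largest number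
   present, so counting instructions is enough to bound the logarithmic cost. *)
Definition runs (p : cmd) (s : state) (t : nat) (s' : state) : Prop :=
  forall b, bounded b s ->
    exists c, [/\ exec p s c s', c <= 3 * t * (b + t).+1 & bounded (b + t) s'].

Lemma bitlen_le b x : x <= 2 ^ b -> bitlen x <= b.+1.
Proof.
move=> x_le; rewrite /bitlen ltnS.
apply: leq_trans (leq_trunc_log 2 x_le) _.
by rewrite trunc_expnK.
Qed.

Lemma boundedW b b' s : b <= b' -> bounded b s -> bounded b' s.
Proof.
move=> bb' [h1 h2]; have le2 : 2 ^ b <= 2 ^ b' by rewrite leq_exp2l.
by split=> x; [apply: leq_trans (h1 x) _ | apply: leq_trans (h2 x) _].
Qed.

Lemma bounded_set_reg b s r v : bounded b s -> v <= 2 ^ b -> bounded b (set_reg s r v).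
Proof. by move=> [h1 h2] hv; split=> x //=; rewrite /upd; case: ifP. Qed.

Lemma bounded_set_cell b s a v : bounded b s -> v <= 2 ^ b -> bounded b (set_cell s a v).
Proof. by move=> [h1 h2] hv; split=> x //=; rewrite /upd; case: ifP. Qed.

Lemma runs_Skip s : runs CSkip s 1 s.
Proof.
move=> b bs; exists 1; split; [exact: exec_Skip | lia | by apply: boundedW bs; lia].
Qed.

(** The constant may exceed every number present, so it is charged [n.+1] units; [n < 2 ^ n] then
    keeps the result within the exponent. *)
Lemma runs_Const s r n : runs (CConst r n) s n.+1 (set_reg s r n).
Proof.
move=> b bs; exists (bitlen n); have hn : n < 2 ^ n by rewrite ltn_expl.
have hb := bitlen_le (ltnW hn).
split; [exact: exec_Const | nia | apply: bounded_set_reg].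
  by apply: boundedW bs; rewrite leq_addr.
by apply: leq_trans (ltnW hn) _; rewrite leq_exp2l //; lia.
Qed.

Lemma runs_Add s r a b : runs (CAdd r a b) s 1 (set_reg s r (regs s a + regs s b)).
Proof.
move=> B bs; eexists; split; first exact: exec_Add.
- have [h _] := bs; have ha := h a; have hb := h b.
  have hs : regs s a + regs s b <= 2 ^ B.+1 by rewrite expnS; lia.
  have := bitlen_le ha; have := bitlen_le hb; have := bitlen_le hs; lia.
- apply: bounded_set_reg; first by apply: boundedW bs; lia.
  by rewrite addn1 expnS; have [h _] := bs; have := h a; have := h b; lia.
Qed.

Lemma runs_Sub s r a b : runs (CSub r a b) s 1 (set_reg s r (regs s a - regs s b)).
Proof.
move=> B bs; eexists; split; first exact: exec_Sub.
- have [h _] := bs; have ha := h a; have hb := h b.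
  have hs : regs s a - regs s b <= 2 ^ B by lia.
  have := bitlen_le ha; have := bitlen_le hb; have := bitlen_le hs; lia.
- apply: bounded_set_reg; first by apply: boundedW bs; lia.
  by rewrite addn1 expnS; have [h _] := bs; have := h a; have := h b; lia.
Qed.

Lemma runs_Load s r a : runs (CLoad r a) s 1 (set_reg s r (cells s (regs s a))).
Proof.
move=> B bs; eexists; split; first exact: exec_Load.
- have [h h'] := bs; have := bitlen_le (h a); have := bitlen_le (h' (regs s a)); lia.
- apply: bounded_set_reg; first by apply: boundedW bs; lia.
  by rewrite addn1 expnS; have [_ h] := bs; have := h (regs s a); lia.
Qed.

Lemma runs_Store s a r : runs (CStore a r) s 1 (set_cell s (regs s a) (regs s r)).
Proof.
move=> B bs; eexists; split; first exact: exec_Store.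
- have [h _] := bs; have := bitlen_le (h a); have := bitlen_le (h r); lia.
- apply: bounded_set_cell; first by apply: boundedW bs; lia.
  by rewrite addn1 expnS; have [h _] := bs; have := h r; lia.
Qed.

Lemma runs_Seq p q s t s' t' s'' :
  runs p s t s' -> runs q s' t' s'' -> runs (CSeq p q) s (t + t') s''.
Proof.
move=> hp hq b bs; have [c [ec hc bs']] := hp b bs.
have [c' [ec' hc' bs'']] := hq _ bs'.
exists (c + c'); split; first exact: exec_Seq ec ec'; last by rewrite addnA.
rewrite mulnDr mulnDl leq_add //.
  by apply: leq_trans hc _; rewrite leq_mul2l; lia.
by apply: leq_trans hc' _; rewrite leq_mul2l; lia.
Qed.

Lemma runsW p s t t' s' : t <= t' -> runs p s t s' -> runs p s t' s'.
Proof.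
move=> tt' hp b bs; have [c [ec hc bs']] := hp b bs.
exists c; split=> //; last by apply: boundedW bs'; lia.
by apply: leq_trans hc _; apply: leq_mul; lia.
Qed.

Lemma runs_If r p q s t s' :
  runs (if regs s r != 0 then p else q) s t s' -> runs (CIf r p q) s t.+1 s'.
Proof.
move=> h b bs; have [c [ec hc bs']] := h b bs.
have hr := bitlen_le (bs.1 r).
exists (bitlen (regs s r) + c); split; last by apply: boundedW bs'; lia.
  by case: eqP ec => [e0|/eqP e0] /= ec; [apply: exec_IfFalse | apply: exec_IfTrue].
have : 3 * t * (b + t).+1 <= 3 * t * (b + t.+1).+1 by rewrite leq_mul2l; lia.
have -> : 3 * t.+1 * (b + t.+1).+1 = 3 * (b + t.+1).+1 + 3 * t * (b + t.+1).+1 by lia.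
lia.
Qed.

Lemma runs_WhileFalse r p s : regs s r = 0 -> runs (CWhile r p) s 1 s.
Proof.
move=> r0 b bs; have hr := bitlen_le (bs.1 r).
by eexists; split; [exact: exec_WhileFalse | lia | apply: boundedW bs; lia].
Qed.

Lemma runs_WhileTrue r p s t s' t' s'' :
  regs s r != 0 -> runs p s t s' -> runs (CWhile r p) s' t' s'' ->
  runs (CWhile r p) s (t + t').+1 s''.
Proof.
move=> r0 hp hq b bs; have [c [ec hc bs']] := hp b bs.
have [c' [ec' hc' bs'']] := hq _ bs'.
have hr := bitlen_le (bs.1 r).
exists (bitlen (regs s r) + c + c'); split; first exact: exec_WhileTrue ec ec'.
  have h1 : c <= 3 * t * (b + (t + t').+1).+1.
    by apply: leq_trans hc _; rewrite leq_mul2l; lia.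
  have h2 : c' <= 3 * t' * (b + (t + t').+1).+1.
    by apply: leq_trans hc' _; rewrite leq_mul2l; lia.
  set z := (b + (t + t').+1).+1 in h1 h2 *.
  have h3 : bitlen (regs s r) <= 3 * z by rewrite /z; lia.
  have -> : 3 * (t + t').+1 * z = 3 * z + 3 * t * z + 3 * t' * z by nia.
  lia.
by apply: boundedW bs''; lia.
Qed.

(* Register 0 is never written, register 1 holds the constant one and register 2
   the number of vertices, which bounds every loop. *)
Notation r0 := 0 (only parsing).
Notation r1 := 1 (only parsing).
Notation rn := 2 (only parsing).

(** Every loop makes exactly [n] rounds, so programs are total. [PFor i d p] keeps the round number
    in [i] and the number of rounds left in [d], because a machine loop can only test a register for
    being nonzero. *)
Inductive prog : Type :=
| PSkip
| PConst of nat & nat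
| PAdd of nat & nat & nat
| PSub of nat & nat & nat
| PLoad of nat & nat
| PStore of nat & nat
| PSeq of prog & prog
| PIf of nat & prog & prog
| PFor of nat & nat & prog.

Fixpoint compile (p : prog) : cmd :=
  match p with
  | PSkip => CSkip
  | PConst r c => CConst r c
  | PAdd r a b => CAdd r a b
  | PSub r a b => CSub r a b
  | PLoad r a => CLoad r a
  | PStore a r => CStore a r
  | PSeq p q => CSeq (compile p) (compile q)
  | PIf r p q => CIf r (compile p) (compile q)
  | PFor i d p =>
    CSeq (CConst i 0) (CSeq (CSub d rn i)
      (CWhile d (CSeq (compile p) (CSeq (CAdd i i r1) (CSub d rn i)))))
  end.

Definition set_counter (n i d j : nat) (s : state) : state :=
  set_reg (set_reg s i j) d (n - j).

Fixpoint den (n : nat) (p : prog) (s : state) : state :=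
  match p with
  | PSkip => s
  | PConst r c => set_reg s r c
  | PAdd r a b => set_reg s r (regs s a + regs s b)
  | PSub r a b => set_reg s r (regs s a - regs s b)
  | PLoad r a => set_reg s r (cells s (regs s a))
  | PStore a r => set_cell s (regs s a) (regs s r)
  | PSeq p q => den n q (den n p s)
  | PIf r p q => if regs s r != 0 then den n p s else den n q s
  | PFor i d p =>
    iteri n (fun j s => set_counter n i d j.+1 (den n p s)) (set_counter n i d 0 s)
  end.

(** The branches of a test are added, which bounds either of them. A round costs 3 beyond its body:
    the increment of [i], the new value of [d] and the loop test. Another 3 pay for the two
    initialisations and the final test. *)
Fixpoint time (n : nat) (p : prog) : nat :=
  match p with
  | PConst _ c => c.+1
  | PSeq p q => time n p + time n q
  | PIf _ p q => (time n p + time n q).+1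
  | PFor _ _ p => n * (time n p + 3) + 3
  | _ => 1
  end.

Fixpoint writes (p : prog) : seq nat :=
  match p with
  | PConst r _ | PAdd r _ _ | PSub r _ _ | PLoad r _ => [:: r]
  | PSeq p q | PIf _ p q => writes p ++ writes q
  | PFor i d p => [:: i, d & writes p]
  | _ => [::]
  end.

Fixpoint loops_ok (p : prog) : bool :=
  match p with
  | PSeq p q | PIf _ p q => loops_ok p && loops_ok q
  | PFor i d p =>
    [&& i != d, i \notin writes p, d \notin writes p & loops_ok p]
  | _ => true
  end.

Definition wf (p : prog) : bool :=
  [&& r1 \notin writes p, rn \notin writes p & loops_ok p].

Lemma den_frame n p s r : r \notin writes p -> regs (den n p s) r = regs s r.
Proof.
elim: p s => //=.
- by move=> a c s; rewrite inE /upd => /negbTE ->.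
- by move=> a b c s; rewrite inE /upd => /negbTE ->.
- by move=> a b c s; rewrite inE /upd => /negbTE ->.
- by move=> a b s; rewrite inE /upd => /negbTE ->.
- by move=> p IHp q IHq s; rewrite mem_cat negb_or => /andP[hp hq]; rewrite IHq // IHp.
- move=> a p IHp q IHq s; rewrite mem_cat negb_or => /andP[hp hq].
  by case: ifP => _; rewrite ?IHp ?IHq.
- move=> i d p IHp s; rewrite !inE !negb_or => /and3P[ri rd rp].
  have frame j s1 : regs (set_counter n i d j s1) r = regs s1 r.
    by rewrite /= /upd (negbTE ri) (negbTE rd).
  elim: {1}n => [|m IHm]; first by rewrite frame.
  by rewrite iteriS frame IHp // IHm.
Qed.

Lemma den_runs n p s : wf p -> regs s r1 = 1 -> regs s rn = n ->
  runs (compile p) s (time n p) (den n p s).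
Proof.
case/and3P; elim: p s.
- by move=> *; exact: runs_Skip.
- by move=> *; exact: runs_Const.
- by move=> *; exact: runs_Add.
- by move=> *; exact: runs_Sub.
- by move=> *; exact: runs_Load.
- by move=> *; exact: runs_Store.
- move=> p IHp q IHq s /=; rewrite !mem_cat !negb_or.
  move=> /andP[p1 q1] /andP[pn qn] /andP[lp lq] s1 sn.
  by apply: runs_Seq (IHp _ _ _ _ _ _) (IHq _ _ _ _ _ _); rewrite // den_frame.
- move=> r p IHp q IHq s /=; rewrite !mem_cat !negb_or.
  move=> /andP[p1 q1] /andP[pn qn] /andP[lp lq] s1 sn; apply: runs_If.
  case: ifP => _.
    by apply: runsW (IHp _ _ _ _ _ _); rewrite // leq_addr.
  by apply: runsW (IHq _ _ _ _ _ _); rewrite // leq_addl.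
- move=> i d p IHp s /=; rewrite !inE !negb_or.
  move=> /and3P[i1 d1 p1] /and3P[i_n d_n pn] /and4P[id ip dp lp] s1 sn.
  have -> : n * (time n p + 3) + 3 = 1 + (1 + (n * (time n p + 3) + 1)) by lia.
  apply: (runs_Seq (@runs_Const s i 0)); apply: (runs_Seq (@runs_Sub _ d rn i)).
  rewrite [set_reg _ d _](_ : _ = set_counter n i d 0 s); last first.
    by rewrite /set_counter /= /upd (negbTE i_n) eqxx sn.
  set body := fun j s => _.
  (* State at the head of round [j]: the two constants survive and the counters are in step. *)
  have good j : j <= n -> let s' := iteri j body (set_counter n i d 0 s) in
      [/\ regs s' r1 = 1, regs s' rn = n, regs s' i = j & regs s' d = n - j].
    have cnt m s2 : [/\ regs (set_counter n i d m s2) r1 = regs s2 r1,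
        regs (set_counter n i d m s2) rn = regs s2 rn,
        regs (set_counter n i d m s2) i = m & regs (set_counter n i d m s2) d = n - m].
      by rewrite /= /upd !eqxx (negbTE i1) (negbTE i_n) (negbTE d1) (negbTE d_n) (negbTE id).
    elim: j => [|j IHj] jn.
      rewrite /iteri; have [e1 en ei ed] := cnt 0 s.
      by split; rewrite ?e1 ?en.
    have [e1 en _ _] := IHj (ltnW jn).
    rewrite iteriS /body; set s2 := iteri j _ _ in e1 en *.
    have [f1 fn fi fd] := cnt j.+1 (den n p s2).
    by split; rewrite ?f1 ?fn // den_frame.
  suff loop m j : m + j = n ->
      runs (CWhile d (CSeq (compile p) (CSeq (CAdd i i r1) (CSub d rn i))))
        (iteri j body (set_counter n i d 0 s)) (m * (time n p + 3) + 1)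
        (iteri n body (set_counter n i d 0 s)).
    by apply: (loop n 0); rewrite addn0.
  elim: m j => [|m IHm] j mj.
    have jn : j = n by lia.
    have [_ _ _ ed] := good n (leqnn n); rewrite jn; apply: runs_WhileFalse.
    by rewrite ed subnn.
  have jn : j <= n by lia.
  have [e1 en ei ed] := good j jn.
  rewrite [_ + 1](_ : _ = (time n p + (1 + 1) + (m * (time n p + 3) + 1)).+1); last lia.
  apply: runs_WhileTrue (IHm j.+1 _); [by rewrite ed; lia| |lia].
  apply: runs_Seq; first exact: IHp.
  apply: (runs_Seq (@runs_Add _ _ _ _)) => /=.
  set s2 := iteri j _ _ in e1 en ei ed *.
  rewrite /body.
  rewrite [set_counter _ _ _ _ _](_ : _ = set_reg (set_reg (den n p s2) i (regs (den n p s2) i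
    + regs (den n p s2) r1)) d
     (regs (set_reg (den n p s2) i (regs (den n p s2) i + regs (den n p s2) r1)) rn -
      regs (set_reg (den n p s2) i (regs (den n p s2) i + regs (den n p s2) r1)) i)).
    exact: runs_Sub.
  rewrite /set_counter /= /upd eqxx (negbTE i_n) !den_frame //.
  by rewrite e1 en ei addn1.
Qed.

Lemma time_poly p : exists c d, forall n, time n p <= c * n.+1 ^ d.
Proof.
have pow n d : 0 < n.+1 ^ d by rewrite expn_gt0.
elim: p.
- by exists 1, 0 => n /=; rewrite expn0.
- by move=> r c; exists c.+1, 0 => n /=; rewrite expn0 muln1.
- by move=> r a b; exists 1, 0 => n /=; rewrite expn0.
- by move=> r a b; exists 1, 0 => n /=; rewrite expn0.
- by move=> r a; exists 1, 0 => n /=; rewrite expn0.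
- by move=> r a; exists 1, 0 => n /=; rewrite expn0.
- move=> p [c [d h]] q [c' [d' h']]; exists (c + c'), (d + d') => n /=.
  have := h n; have := h' n; have := pow n d; have := pow n d'; rewrite expnD; nia.
- move=> r p [c [d h]] q [c' [d' h']]; exists (c + c').+1, (d + d') => n /=.
  have := h n; have := h' n; have := pow n d; have := pow n d'; rewrite expnD; nia.
- move=> i j p [c [d h]]; exists (c + 3), d.+1 => n /=.
  have := h n; have := pow n d; rewrite expnS; nia.
Qed.

Lemma iteri_inv (T : Type) (Q : nat -> T -> Prop) (g : nat -> T -> T) n x :
  Q 0 x -> (forall j y, j < n -> Q j y -> Q j.+1 (g j y)) -> Q n (iteri n g x).
Proof.
move=> Q0 QS; elim: {-2}n (leqnn n) => [|m IHm] // mn.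
by rewrite iteriS; apply: QS => //; apply: IHm; apply: ltnW.
Qed.

(** * Merging cliques *)

Section Labellings.
Variables (V : finType) (kappa : V -> nat).
Implicit Types (K P : {set V}) (phi : V -> nat) (eta : nat).

(** A labelling stands for the cluster graph whose components are its classes; [K] is the vertex set
    of the induced subgraph in question. [kappa] gives the original cliques, [phi] the groups. *)
Definition fiber K phi x := [set y in K | phi y == phi x].
Definition fsize K phi x := #|fiber K phi x|.
Definition rank K x := #|[set y in K | kappa y <= kappa x]|.

Definition coarser K phi := {in K &, forall x y, kappa x = kappa y -> phi x = phi y}.

(* Both sides count ordered pairs, which is why the budget appears doubled. *)
Definition cheap K k2 phi :=
  \sum_(x in K) fsize K phi x <= \sum_(x in K) fsize K kappa x + k2.

Definition even K eta phi := {in K &, forall x y, fsize K phi x <= fsize K phi y + eta}.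

Definition solution K k2 eta phi := [/\ coarser K phi, cheap K k2 phi & even K eta phi].

Definition affected K phi := [set x in K | fsize K kappa x < fsize K phi x].

Definition size_monotone K :=
  {in K &, forall x y, kappa x <= kappa y -> fsize K kappa x <= fsize K kappa y}.

Lemma in_fiber K phi x y : (y \in fiber K phi x) = (y \in K) && (phi y == phi x).
Proof. by rewrite inE. Qed.

Lemma eq_fiber K phi x y : phi x = phi y -> fiber K phi x = fiber K phi y.
Proof. by move=> e; apply/setP=> z; rewrite !inE e. Qed.

Lemma fiber_sub K phi x : coarser K phi -> x \in K -> fiber K kappa x \subset fiber K phi x.
Proof.
move=> cphi xK; apply/subsetP=> y; rewrite !in_fiber => /andP[yK /eqP e].
by rewrite yK; apply/eqP/cphi.
Qed.

Lemma unaffected_fiber K phi x : coarser K phi -> x \in K -> x \notin affected K phi ->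
  fiber K phi x = fiber K kappa x.
Proof.
move=> cphi xK; rewrite inE xK -leqNgt => le.
by apply/esym/eqP; rewrite eqEcard fiber_sub.
Qed.

Lemma merged_affected K phi x y : coarser K phi -> x \in K -> y \in K ->
  phi x = phi y -> kappa x != kappa y -> x \in affected K phi.
Proof.
move=> cphi xK yK e ne; rewrite inE xK; apply: proper_card.
rewrite properE fiber_sub //; apply/subsetPn; exists y.
  by rewrite in_fiber yK e eqxx.
by rewrite in_fiber yK eq_sym.
Qed.

Lemma card_affected K k2 phi : coarser K phi -> cheap K k2 phi -> #|affected K phi| <= k2.
Proof.
move=> cphi; rewrite /cheap => h.
rewrite -(leq_add2l (\sum_(x in K) fsize K kappa x)); apply: leq_trans h.
have -> : #|affected K phi| = \sum_(x in K) (x \in affected K phi).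
  rewrite -sum1_card big_mkcond [RHS]big_mkcond /=; apply: eq_bigr => x _.
  by rewrite inE; case: (x \in K).
rewrite -big_split /=; apply: leq_sum => x xK.
have := subset_leq_card (fiber_sub cphi xK).
by rewrite inE xK /= /fsize; case: ltnP => //=; lia.
Qed.

Lemma leq_sum_subset (A B : {set V}) (F : V -> nat) :
  A \subset B -> \sum_(x in A) F x <= \sum_(x in B) F x.
Proof. by move=> /setIidPr AB; rewrite [X in _ <= X](big_setID A) /= AB leq_addr. Qed.

Lemma leq_sum_setU (A B : {set V}) (F : V -> nat) :
  \sum_(x in A :|: B) F x <= \sum_(x in A) F x + \sum_(x in B) F x.
Proof.
rewrite (big_setID A) /= setUK leq_add2l leq_sum_subset //.
by rewrite setDUl setDv set0U subsetDl.
Qed.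

(** A group of size [g] contains a clique of size [b], next to an unmerged clique of size [b']; the
    left side is the cost after swapping the two. With [m = g - b] the claim reduces to
    [b' * m <= b * m]. *)
Lemma exchange_squares b b' g : b' <= b -> b <= g ->
  b * b + (b' + (g - b)) * (b' + (g - b)) <= g * g + b' * b'.
Proof.
move=> leb leg; have -> : g = b + (g - b) by lia.
have : (g - b) * b' <= (g - b) * b by rewrite leq_mul2l leb orbT.
by rewrite addKn; move: (g - b) => m; lia.
Qed.

(** The clique [B] of [b] leaves its group [G] and the clique [B'] of [b'] takes its place. All
    other groups are unchanged, the cost does not grow by [exchange_squares], and the new group has
    a size between those of [B'] and [G], so balance is kept. *)
Lemma exchange K k2 eta phi b b' : size_monotone K -> solution K k2 eta phi ->
  b \in affected K phi -> b' \in K -> b' \notin affected K phi -> kappa b' < kappa b ->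
  exists2 psi, solution K k2 eta psi &
    affected K psi \subset (affected K phi :\: fiber K kappa b) :|: fiber K kappa b'.
Proof.
move=> mono [cphi hc he] bA b'K b'A lt.
have bK : b \in K by move: bA; rewrite inE => /andP[].
(* Since [b'] is unaffected, its label is used by [B'] alone and is free for [B] once [B'] has
   moved. *)
pose psi y := if kappa y == kappa b then phi b' else
              if kappa y == kappa b' then phi b else phi y.
set B := fiber K kappa b; set B' := fiber K kappa b'; pose G := fiber K phi b.
have eB' : fiber K phi b' = B' by apply: unaffected_fiber.
have sBG : B \subset G by apply: fiber_sub.
have nphi : phi b' != phi b.
  by apply: contra b'A => /eqP e; apply: merged_affected e _ => //; rewrite ltn_eqF.
have dG : [disjoint B' & G].
  rewrite -eB'; apply/pred0P=> z /=; rewrite !in_fiber; apply/negP.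
  by move=> /andP[/andP[_ /eqP ->] /andP[_ /eqP e]]; rewrite e eqxx in nphi.
have nB'B z : z \in B' -> z \notin B.
  by rewrite !in_fiber => /andP[-> /eqP ->] /=; rewrite ltn_eqF.
have inB' z : z \in K -> (phi z == phi b') = (z \in B').
  by move=> zK; rewrite -eB' in_fiber zK.
have inG z : z \in K -> (z \in G) = (phi z == phi b) by move=> zK; rewrite in_fiber zK.
(* The group of [b] after the swap. *)
pose X := B' :|: (G :\: B).
have psiE z : z \in K -> psi z = if z \in B then phi b' else if z \in X then phi b else phi z.
  move=> zK; rewrite /psi /X in_setU in_setD /B /B' /G !in_fiber zK /=.
  case: (kappa z == kappa b) => //=.
  by case: (kappa z == kappa b') => //=; case: eqP.
have BK : B \subset K by apply/subsetP=> z; rewrite inE => /andP[].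
have XK : X \subset K.
  by apply/subsetP=> z; rewrite !inE => /orP[/andP[]|/andP[_ /andP[]]].
have fB z : z \in B -> fiber K psi z = B.
  move=> zB; apply/setP=> y; rewrite in_fiber; case yK: (y \in K) => /=; last first.
    by apply/esym/negbTE/negP => /(subsetP BK); rewrite yK.
  rewrite !psiE ?(subsetP BK z zB) // zB; case yB: (y \in B); first by rewrite eqxx.
  case yX: (y \in X); first by rewrite eq_sym (negbTE nphi).
  by rewrite inB' //; apply/negbTE; move: yX; rewrite inE => /negbT; rewrite negb_or => /andP[].
have nXB z : z \in X -> (z \in B) = false.
  rewrite inE => /orP[/nB'B /negbTE //|]; by rewrite inE => /andP[/negbTE].
have fX z : z \in X -> fiber K psi z = X.
  move=> zX; apply/setP=> y; rewrite in_fiber; case yK: (y \in K) => /=; last first.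
    by apply/esym/negbTE/negP => /(subsetP XK); rewrite yK.
  rewrite !psiE ?(subsetP XK z zX) // zX (nXB z zX); case yB: (y \in B).
    by rewrite (negbTE nphi); apply/esym/negbTE/negP => /nXB; rewrite yB.
  case yX: (y \in X); first by rewrite eqxx.
  apply/negbTE; move: yX; rewrite /X in_setU in_setD yB inG // => /negbT.
  by rewrite negb_or => /andP[].
have fO z : z \in K -> z \notin B -> z \notin X -> fiber K psi z = fiber K phi z.
  move=> zK zB zX; apply/setP=> y; rewrite !in_fiber; case yK: (y \in K) => //=.
  rewrite !psiE // (negbTE zB) (negbTE zX).
  have nzb : (phi z == phi b) = false.
    apply/negbTE; move: zX; rewrite /X in_setU in_setD zB inG //.
    by rewrite negb_or => /andP[].
  have nzb' : (phi z == phi b') = false.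
    by rewrite inB' //; apply/negbTE; move: zX; rewrite in_setU negb_or => /andP[].
  case yB: (y \in B).
    rewrite eq_sym nzb'; apply/esym/negbTE.
    have : y \in G by apply: (subsetP sBG).
    by rewrite inG // => /eqP ->; rewrite eq_sym nzb.
  case yX: (y \in X) => //; rewrite eq_sym nzb; apply/esym.
  move: yX; rewrite inE => /orP[|]; first by rewrite -inB' // => /eqP ->; rewrite eq_sym nzb'.
  by rewrite in_setD inG // => /andP[_ /eqP ->]; rewrite eq_sym nzb.
have cpsi : coarser K psi by move=> x y xK yK e; rewrite /psi e; case: ifP => // _;
  case: ifP => // _; apply: cphi.
have cardX : #|X| = #|B'| + (#|G| - #|B|).
  rewrite /X cardsU cardsD; have /setIidPr -> := sBG.
  rewrite [B' :&: _](_ : _ = set0) ?cards0 ?subn0 //.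
  apply/eqP; rewrite setI_eq0; apply: disjointWr dG; exact: subsetDl.
have leBG := subset_leq_card sBG.
have leB : #|B'| <= #|B| by apply: mono => //; apply: ltnW.
(* Every new size lies between two old ones, so the spread of the sizes cannot increase. *)
have low x : x \in K -> exists2 y, y \in K & fsize K phi y <= fsize K psi x.
  move=> xK; case xB: (x \in B); first by exists b' => //; rewrite /fsize eB' fB.
  case xX: (x \in X); first by exists b' => //; rewrite /fsize eB' fX // cardX leq_addr.
  by exists x => //; rewrite /fsize fO ?xB ?xX.
have high x : x \in K -> exists2 y, y \in K & fsize K psi x <= fsize K phi y.
  move=> xK; case xB: (x \in B); first by exists b => //; rewrite /fsize fB.
  case xX: (x \in X); first by exists b => //;
    rewrite /fsize fX // cardX addnBA // leq_subLR leq_add2r.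
  by exists x => //; rewrite /fsize fO ?xB ?xX.
exists psi; last first.
  apply/subsetP=> x; rewrite inE => /andP[xK]; rewrite in_setU in_setD; case xB: (x \in B).
    by rewrite /fsize fB // (_ : fiber K kappa x = B) ?ltnn //; apply: eq_fiber; move: xB;
      rewrite in_fiber => /andP[_ /eqP].
  case xX: (x \in X) => /=; last by rewrite /fsize fO ?xB ?xX // => h; rewrite inE xK h.
  move=> _; move: xX; rewrite inE => /orP[-> |]; first by rewrite orbT.
  rewrite inE => /andP[_]; rewrite in_fiber => /andP[_ /eqP e]; apply/orP; left.
  by apply: merged_affected e _ => //; move: xB; rewrite in_fiber xK /= => ->.
split=> //; last first.
  move=> x y xK yK; have [x' x'K lx] := high x xK; have [y' y'K ly] := low y yK.
  by apply: leq_trans lx (leq_trans (he x' y' x'K y'K) _); rewrite leq_add2r.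
apply: leq_trans hc.
(* Only vertices of [W] change their group, so the costs need comparing on [W] alone: split as [B]
   and [X] after the swap, as [G] and [B'] before. *)
pose W := B' :|: G.
have WK : W \subset K by apply/subsetP=> z; rewrite !inE => /orP[] /andP[].
have bW : B \subset W by apply: subset_trans sBG _; apply: subsetUr.
have split f : \sum_(x in K) f x = \sum_(x in W) f x + \sum_(x in K :\: W) f x :> nat.
  by rewrite (big_setID W) /=; have /setIidPr -> := WK.
rewrite !split; apply: leq_add; last first.
  apply: eq_leq; apply: eq_bigr => x; rewrite !in_setD /W in_setU negb_or => /andP[/andP[h1 h2] xK].
  rewrite /fsize fO // ?(contra (subsetP sBG x)) // in_setU in_setD (negbTE h1) (negbTE h2).
  by rewrite andbF.
rewrite (big_setID B) /= [X in _ <= X](big_setID G) /=.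
have /setIidPr -> := bW; have /setIidPr -> : G \subset W by apply: subsetUr.
have -> : W :\: B = X.
  apply/setP=> z; rewrite !in_setD !in_setU in_setD; case zB: (z \in B') => //=.
  by rewrite nB'B.
have -> : W :\: G = B'.
  apply/setP=> z; rewrite !in_setD !in_setU; case zG: (z \in G); rewrite ?orbF //=.
  by apply/esym/negbTE; apply: contraL zG => zB'; rewrite (disjointFr dG).
have s1 : \sum_(x in B) fsize K psi x = #|B| * #|B|.
  by rewrite -sum_nat_const; apply: eq_bigr => x xB; rewrite /fsize fB.
have s2 : \sum_(x in X) fsize K psi x = #|X| * #|X|.
  by rewrite -sum_nat_const; apply: eq_bigr => x xB; rewrite /fsize fX.
have s3 : \sum_(x in G) fsize K phi x = #|G| * #|G|.
  rewrite -sum_nat_const; apply: eq_bigr => x; rewrite in_fiber => /andP[_ /eqP e].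
  by rewrite /fsize (eq_fiber _ e).
have s4 : \sum_(x in B') fsize K phi x = #|B'| * #|B'|.
  rewrite -sum_nat_const -eB'; apply: eq_bigr => x; rewrite in_fiber => /andP[_ /eqP e].
  by rewrite /fsize (eq_fiber _ e).
rewrite s1 s2 s3 s4 cardX.
exact: exchange_squares.
Qed.

(** Each exchange lowers the sum of the keys of the affected vertices, since it replaces a clique by
    one that is no larger and has a smaller key. When no exchange is possible, every vertex with a
    key below that of an affected vertex is affected too, so the rank is at most the number of
    affected vertices. *)
Lemma prefix_solution K k2 eta phi : size_monotone K -> solution K k2 eta phi ->
  exists2 psi, solution K k2 eta psi & {in affected K psi, forall x, rank K x <= k2}.
Proof.
move=> mono.
have [m] := ubnP (\sum_(x in affected K phi) kappa x).
elim: m phi => // m IHm phi lt_m sol.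
have [/exists_inP[b bA /exists_inP[b' b'K /andP[b'A lt]]]|no] := boolP
  [exists b in affected K phi, exists b' in K, (b' \notin affected K phi) && (kappa b' < kappa b)].
  have [psi spsi sub] := exchange mono sol bA b'K b'A lt.
  apply: (IHm psi) => //.
  have bK : b \in K by move: bA; rewrite inE => /andP[].
  have [cphi _ _] := sol.
  have BA : fiber K kappa b \subset affected K phi.
    apply/subsetP=> x; rewrite in_fiber => /andP[xK /eqP e].
    move: bA; rewrite !inE bK xK /= /fsize (eq_fiber _ e).
    by rewrite (@eq_fiber K phi x b) //; apply: cphi.
  have le1 : \sum_(x in affected K psi) kappa x <=
      \sum_(x in affected K phi :\: fiber K kappa b) kappa x + \sum_(x in fiber K kappa b') kappa x.
    exact: leq_trans (leq_sum_subset _ sub) (leq_sum_setU _ _ _).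
  have sumE x : \sum_(y in fiber K kappa x) kappa y = #|fiber K kappa x| * kappa x.
    by rewrite -sum_nat_const; apply: eq_bigr => y; rewrite in_fiber => /andP[_ /eqP].
  rewrite ltnS in lt_m; apply: leq_trans lt_m.
  rewrite [X in _ < X](big_setID (fiber K kappa b)) /=.
  have /setIidPr -> := BA; rewrite sumE; rewrite sumE in le1.
  have leB : #|fiber K kappa b'| <= #|fiber K kappa b| by apply: mono => //; apply: ltnW.
  have : 0 < #|fiber K kappa b| by apply/card_gt0P; exists b; rewrite in_fiber bK eqxx.
  move: le1; set u := \sum_(x in _ :\: _) _; set w := \sum_(x in _) _ => le1 lt0.
  apply: leq_ltn_trans le1 _; rewrite addnC ltn_add2r.
  apply: leq_ltn_trans (_ : #|fiber K kappa b| * kappa b' < _).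
    by rewrite leq_mul2r leB orbT.
  by rewrite ltn_mul2l lt0 lt.
exists phi => // x xA; have [cphi hc _] := sol.
apply: leq_trans (card_affected cphi hc); apply: subset_leq_card.
apply/subsetP=> y; rewrite inE => /andP[yK]; rewrite leq_eqVlt => /orP[/eqP e|lt].
  have xK : x \in K by move: xA; rewrite inE => /andP[].
  move: xA; rewrite !inE xK yK /= /fsize (eq_fiber _ e).
  by rewrite (@eq_fiber K phi y x) //; apply: cphi.
move: no; rewrite negb_exists_in => /forall_inP/(_ x xA).
rewrite negb_exists_in => /forall_inP/(_ y yK); by rewrite lt andbT negbK.
Qed.

(** * Replaying solutions on other vertex sets *)

Definition saturated P := forall x y, x \in P -> kappa y = kappa x -> y \in P.

Lemma saturated_fsize K P x : P \subset K -> saturated P -> x \in P ->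
  fsize K kappa x = fsize P kappa x.
Proof.
move=> PK sP xP; apply: eq_card => y; rewrite !in_fiber.
case yP: (y \in P); first by rewrite (subsetP PK).
by apply/negbTE/negP => /andP[_ /eqP e]; rewrite (sP x y xP e) in yP.
Qed.

Lemma cheap_local K P k2 phi : P \subset K ->
  (forall x, x \in K -> x \notin P -> fsize K phi x = fsize K kappa x) ->
  cheap K k2 phi <-> \sum_(x in P) fsize K phi x <= \sum_(x in P) fsize K kappa x + k2.
Proof.
move=> /setIidPr PK eqK; rewrite /cheap (big_setID P) [X in _ <= X + _](big_setID P) /= PK.
rewrite (eq_bigr (fun x => fsize K kappa x) (P := mem (K :\: P))).
  by rewrite addnAC leq_add2r.
by move=> x /setDP[xK xP]; apply: eqK.
Qed.

(** A solution that merges only cliques inside [P] can be replayed on any vertex set containing [P],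
    leaving all other cliques alone. Balance also depends on the cliques outside [P]; the two size
    equations let each application settle it separately. *)
Lemma transfer K K' P k2 phi : P \subset K -> P \subset K' -> saturated P ->
  coarser K phi -> cheap K k2 phi -> affected K phi \subset P ->
  exists psi, [/\ coarser K' psi, cheap K' k2 psi,
    {in P, forall x, fsize K' psi x = fsize K phi x} &
    forall x, x \in K' -> x \notin P -> fsize K' psi x = fsize K' kappa x].
Proof.
move=> PK PK' sP cphi hc AP.
(* parity keeps the labels inside and outside P apart *)
pose psi y := if y \in P then (phi y).*2 else (kappa y).*2.+1.
have eqP' : {in P, forall x, fsize K' psi x = fsize K phi x}.
  move=> x xP; apply: eq_card => y; rewrite !in_fiber /psi xP.
  have xK := subsetP PK x xP.
  case yP: (y \in P).
    by rewrite (subsetP PK) // (subsetP PK') //= (inj_eq double_inj).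
  rewrite [_ == _](_ : _ = false) ?andbF; last by apply/negbTE/eqP; lia.
  apply/esym/negbTE/negP => /andP[yK /eqP e].
  have [ek|ne] := eqVneq (kappa y) (kappa x); first by rewrite (sP x y) in yP.
  by move/negP: yP; apply; apply: (subsetP AP); apply: merged_affected e ne.
have eqnP x : x \in K' -> x \notin P -> fsize K' psi x = fsize K' kappa x.
  move=> xK xP; apply: eq_card => y; rewrite !in_fiber /psi (negbTE xP).
  case yK: (y \in K') => //=; case yP: (y \in P).
    have -> : (kappa y == kappa x) = false.
      by apply/negbTE/eqP => e; rewrite (sP y x) in xP.
    by apply/negbTE/eqP; lia.
  by rewrite eqSS (inj_eq double_inj).
exists psi; split=> //.
- move=> x y xK yK e; rewrite /psi; case xP: (x \in P).
    by rewrite (sP x y) // (cphi x y) ?(subsetP PK) // (sP x y).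
  by case yP: (y \in P); [rewrite (sP y x) in xP | rewrite e].
- apply/(cheap_local _ PK' eqnP); move: hc.
  rewrite (cheap_local (P := P)) //; last first.
    move=> x xK xP; rewrite /fsize unaffected_fiber //.
    by apply: contra xP; apply: (subsetP AP).
  rewrite (eq_bigr (fun x => fsize K' psi x)); last by move=> x /eqP' ->.
  rewrite [X in _ <= X + _](eq_bigr (fun x => fsize K' kappa x)) // => x xP.
  by rewrite !(saturated_fsize (P := P)).
Qed.

(** In the order by keys the clique of [x] occupies the positions from [below x] to [rank setT x].
    [light k2] is the longest initial segment of whole cliques that fits into [k2] positions. *)
Definition below x := #|[set y | kappa y < kappa x]|.
Definition light k2 := [set x | rank setT x <= k2].

Lemma rank_below x : rank setT x = below x + fsize setT kappa x.
Proof.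
rewrite /rank /below /fsize -cardsUI [X in _ = _ + X](_ : _ = 0).
  by rewrite addn0; apply: eq_card => y; rewrite !inE /= leq_eqVlt orbC.
by apply/eqP; rewrite cards_eq0; apply/eqP/setP=> y; rewrite !inE /=; case: ltngtP.
Qed.

Lemma rank_mono K x y : kappa x <= kappa y -> rank K x <= rank K y.
Proof.
move=> le; apply: subset_leq_card; apply/subsetP=> z; rewrite !inE => /andP[->].
by move=> h; apply: leq_trans le.
Qed.

Lemma rank_lt_below x y : kappa x < kappa y -> rank setT x <= below y.
Proof.
move=> lt; apply: subset_leq_card; apply/subsetP=> z; rewrite !inE => h.
by apply: leq_ltn_trans lt.
Qed.

Lemma rankT_max x y : rank setT x = #|V| -> kappa y <= kappa x.
Proof.
move=> e; suff: y \in [set y in setT | kappa y <= kappa x] by rewrite !inE.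
suff /eqP -> : [set y in setT | kappa y <= kappa x] == setT by rewrite inE.
by rewrite eqEcard subsetT cardsT -e /=.
Qed.

Lemma exists_top (x : V) : exists m, rank setT m = #|V|.
Proof.
have [m _ h] := arg_maxnP (P := xpredT) kappa (erefl : xpredT x).
exists m; rewrite /rank -cardsT; apply: eq_card => y; rewrite !inE /=; exact: h.
Qed.

Lemma max_in K x : x \in K -> exists2 m, m \in K & {in K, forall y, kappa y <= kappa m}.
Proof. by move=> xK; have [m mK h] := arg_maxnP kappa xK; exists m. Qed.

Lemma min_in K x : x \in K -> exists2 m, m \in K & {in K, forall y, kappa m <= kappa y}.
Proof. by move=> xK; have [m mK h] := arg_minnP kappa xK; exists m. Qed.

Lemma card_light k2 : #|light k2| <= k2.
Proof.
have [->|[x xP]] := set_0Vmem (light k2); first by rewrite cards0.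
have [m mP h] := max_in xP; have : rank setT m <= k2 by rewrite inE in mP.
by apply: leq_trans; apply: subset_leq_card; apply/subsetP=> y /h; rewrite !inE.
Qed.

Lemma light_saturated k2 : saturated (light k2).
Proof. by move=> x y; rewrite !inE /rank => h ->. Qed.

Lemma affected_light k2 phi : {in affected setT phi, forall x, rank setT x <= k2} ->
  affected setT phi \subset light k2.
Proof. by move=> h; apply/subsetP=> x /h; rewrite inE. Qed.

(** All members of the group of an affected vertex are affected, so the group is no larger than the
    affected set. *)
Lemma affected_fsize K k2 phi x : coarser K phi -> cheap K k2 phi -> x \in affected K phi ->
  fsize K phi x <= k2.
Proof.
move=> cphi hc xA; apply: leq_trans (card_affected cphi hc).
apply: subset_leq_card; apply/subsetP=> y; rewrite in_fiber => /andP[yK /eqP e].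
have xK : x \in K by move: xA; rewrite inE => /andP[].
have [ek|ne] := eqVneq (kappa y) (kappa x); last exact: merged_affected e ne.
by move: xA; rewrite !inE xK yK /= /fsize (eq_fiber _ e) (eq_fiber _ ek).
Qed.

Definition solvable K k2 eta := exists phi, solution K k2 eta phi.

(** * Equivalence of the kernels with the instance *)

Section Kernel.
Variables (k2 eta : nat).
Hypothesis mono : size_monotone setT.
Hypothesis large : k2 < #|V|.

(** In a normalised solution the clique of [m] is unmerged, its rank [#|V|] being above [k2]. So [x]
    must have been merged; this is impossible if its rank exceeds [k2], and otherwise yields a group
    of at most [k2] vertices, which is still too small if the largest clique exceeds [eta + k2]. *)
Lemma too_small_unsolvable x m : rank setT m = #|V| ->
  fsize setT kappa x + eta < fsize setT kappa m ->
  (k2 < rank setT x) || (eta + k2 < fsize setT kappa m) ->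
  ~ solvable setT k2 eta.
Proof.
move=> mtop lt bad [phi0 sol0].
have [phi [cphi hc he] pre] := prefix_solution mono sol0.
have unaff z : k2 < rank setT z -> fsize setT phi z = fsize setT kappa z.
  move=> h; rewrite /fsize unaffected_fiber //.
  by apply/negP => /pre; rewrite leqNgt h.
have em : fsize setT phi m = fsize setT kappa m by rewrite unaff ?mtop.
have hx := he m x (in_setT m) (in_setT x); rewrite em in hx.
have [h|h] := ltnP k2 (rank setT x).
  by rewrite unaff // in hx; move: lt; rewrite ltnNge hx.
move: bad; rewrite ltnNge h /= => big.
have xA : x \in affected setT phi by rewrite inE in_setT /= -(ltn_add2r eta); apply: leq_trans hx.
have := affected_fsize cphi hc xA; move: hx big => /=; clear; lia.
Qed.

(** The light cliques, the one crossing clique with [below c <= k2 < rank setT c], and the largest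
    clique. *)
Definition kernel1 := [set x | (below x <= k2) || (rank setT x == #|V|)].

Lemma light_kernel1 : light k2 \subset kernel1.
Proof. by apply/subsetP=> x; rewrite !inE rank_below => h;
  rewrite (leq_trans (leq_addr _ _) h). Qed.

Lemma kernel1_saturated : saturated kernel1.
Proof. by move=> x y; rewrite !inE /below /rank => h ->. Qed.

Lemma kernel1_fsize x : x \in kernel1 -> fsize kernel1 kappa x = fsize setT kappa x.
Proof. by move=> xK; rewrite [RHS](saturated_fsize (P := kernel1)) // ?subsetT //;
  exact: kernel1_saturated. Qed.

(** Take the last clique starting at or before position [k2]. If it also ended there, some clique
    would remain because [k2 < #|V|], and the next one would start no later than [k2]. *)
Lemma exists_crossing : exists c, below c <= k2 < rank setT c.
Proof.
have /card_gt0P[x _] : 0 < #|V| by apply: leq_ltn_trans large.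
have [a _ amin] := min_in (in_setT x).
pose D := [set y | below y <= k2].
have aD : a \in D.
  rewrite inE (_ : below a = 0) //; apply/eqP; rewrite cards_eq0; apply/eqP/setP=> y.
  by rewrite !inE ltnNge amin.
have [c cD cmax] := max_in aD; exists c; move: (cD); rewrite inE => -> /=.
rewrite ltnNge; apply/negP => rc.
have [E|[y]] := set_0Vmem (~: D).
  suff : #|V| <= k2 by rewrite leqNgt large.
  apply: leq_trans rc; rewrite -cardsT; apply: subset_leq_card.
  apply/subsetP=> y _; rewrite !inE /=; apply: cmax.
  by have := in_set0 y; rewrite -E in_setC => /negbFE.
move=> yD; have [z zD zmin] := min_in yD.
move: zD; rewrite !inE => /negP; apply; apply: leq_trans rc.
apply: subset_leq_card; apply/subsetP=> w; rewrite !inE => lt; apply: cmax.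
by apply: contraT => wD; have := zmin w; rewrite !inE in wD *; rewrite wD leqNgt lt => /(_ isT).
Qed.

(** For the way back, the crossing clique and the largest clique enclose the sizes of all dropped
    cliques. The crossing clique is unmerged in a normalised solution, so it really is a lower bound
    for them. *)
Lemma solvable_kernel1 : solvable setT k2 eta <-> solvable kernel1 k2 eta.
Proof.
split=> [[phi0 sol0]|[phi0 sol0]].
  have [phi [cphi hc he] pre] := prefix_solution mono sol0.
  have [psi [cpsi hc' e1 e2]] := transfer (subsetT _) light_kernel1 (@light_saturated k2)
    cphi hc (affected_light pre).
  have eq x : x \in kernel1 -> fsize kernel1 psi x = fsize setT phi x.
    move=> xK; case xP: (x \in light k2); first exact: e1.
    rewrite e2 ?xP // kernel1_fsize // /fsize unaffected_fiber //.
    by apply/negP => /pre h; rewrite inE h in xP.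
  by exists psi; split=> // x y xK yK; rewrite !eq //; apply: he.
have monoK : size_monotone kernel1.
  by move=> x y xK yK le; rewrite !kernel1_fsize //; apply: mono.
have [phi [cphi hc he] pre] := prefix_solution monoK sol0.
have [c /andP[cb cr]] := exists_crossing.
have cK : c \in kernel1 by rewrite inE cb.
(* Nothing up to the crossing clique is dropped, so ranks agree there, and being of rank at most
   [k2] means the same in the kernel and in the whole graph. *)
have rankK x : kappa x <= kappa c -> rank kernel1 x = rank setT x.
  move=> le; apply: eq_card => y; rewrite !inE /=; case yx: (kappa y <= kappa x);
    rewrite ?andbF // andbT.
  suff -> : below y <= k2 by [].
  apply: leq_trans cb; apply: subset_leq_card; apply/subsetP=> z; rewrite !inE => h.
  by apply: leq_trans h _; apply: leq_trans le.
have crossK x : x \in kernel1 -> rank kernel1 x <= k2 -> rank setT x <= k2.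
  move=> xK h; rewrite -rankK // leqNgt; apply/negP => /ltnW /(rank_mono kernel1).
  by rewrite rankK // => h'; move: (leq_trans cr (leq_trans h' h)); rewrite ltnn.
have AP : affected kernel1 phi \subset light k2.
  apply/subsetP=> x xA; rewrite inE; apply: crossK (pre x xA).
  by move: xA; rewrite inE => /andP[].
have [psi [cpsi hc' e1 e2]] := transfer light_kernel1 (subsetT _) (@light_saturated k2)
    cphi hc AP.
have eq x : x \in kernel1 -> fsize setT psi x = fsize kernel1 phi x.
  move=> xK; case xP: (x \in light k2); first exact: e1.
  rewrite e2 ?xP // -kernel1_fsize // /fsize unaffected_fiber //.
  by apply/negP => /(subsetP AP); rewrite xP.
have [m mtop] := exists_top c.
have mK : m \in kernel1 by rewrite inE mtop eqxx orbT.
have ec : fsize kernel1 phi c = fsize setT kappa c.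
  rewrite -kernel1_fsize // /fsize unaffected_fiber //.
  by apply/negP => /(subsetP AP); rewrite inE leqNgt cr.
have out x : x \notin kernel1 ->
    fsize kernel1 phi c <= fsize setT psi x /\ fsize setT psi x <= fsize kernel1 phi m.
  move=> xK; have xP : x \notin light k2 by apply: contra xK; apply: (subsetP light_kernel1).
  rewrite ec e2 //; split.
    apply: mono => //; rewrite leqNgt; apply/negP => /rank_lt_below h.
    by rewrite inE (leq_trans h cb) in xP.
  apply: leq_trans (_ : fsize setT kappa m <= _); first by apply: mono => //; exact: rankT_max.
  by rewrite -kernel1_fsize //; apply: subset_leq_card; apply: fiber_sub.
have low x : exists2 y, y \in kernel1 & fsize kernel1 phi y <= fsize setT psi x.
  by case xK: (x \in kernel1); [exists x; rewrite ?eq | exists c => //;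
    have [] := out x (negbT xK)].
have high x : exists2 y, y \in kernel1 & fsize setT psi x <= fsize kernel1 phi y.
  by case xK: (x \in kernel1); [exists x; rewrite ?eq | exists m => //;
    have [] := out x (negbT xK)].
exists psi; split=> // x y _ _.
have [x' x'K lx] := high x; have [y' y'K ly] := low y.
by apply: leq_trans lx (leq_trans (he x' y' x'K y'K) _); rewrite leq_add2r.
Qed.

(** The cliques starting by position [k2] end with one that adds at most the largest size; the
    largest clique itself accounts for the second copy. *)
Lemma card_kernel1 m : rank setT m = #|V| -> #|kernel1| <= k2 + 2 * fsize setT kappa m.
Proof.
move=> mtop; pose D := [set y | below y <= k2].
have -> : kernel1 = D :|: fiber setT kappa m.
  apply/setP=> x; rewrite !inE /=; congr (_ || _); apply/eqP/eqP => [xt|e].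
    by apply/eqP; rewrite eqn_leq !rankT_max.
  by rewrite /rank e.
apply: leq_trans (leq_card_setU _ _) _; rewrite mul2n -addnn addnA leq_add2r.
have [->|[x xD]] := set_0Vmem D; first by rewrite cards0.
have [c cD cmax] := max_in xD.
apply: leq_trans (_ : rank setT c <= _).
  by apply: subset_leq_card; apply/subsetP=> y yD; rewrite !inE; apply: cmax.
rewrite rank_below leq_add //; first by rewrite inE in cD.
by apply: mono => //; exact: rankT_max.
Qed.

(* Once the largest clique exceeds every possible group, only its excess over
   [eta] matters, so it can be shrunk to [k2] vertices together with [eta]. *)
Section Shrink.
Variables (m : V) (Q : {set V}).
Hypothesis mtop : rank setT m = #|V|.
Hypothesis mbig : k2 < fsize setT kappa m.
Hypothesis Qtop : Q \subset fiber setT kappa m.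
Hypothesis Qcard : #|Q| = k2.
Hypothesis good : forall x, fsize setT kappa x + eta < fsize setT kappa m ->
  (rank setT x <= k2) && (fsize setT kappa m <= eta + k2).

(** The crossing clique is not kept here: by [good] every clique outside [light k2] is within [eta]
    of the largest one, so only the light cliques can violate balance. *)
Definition kernel2 := light k2 :|: Q.

Lemma m_heavy x : kappa x = kappa m -> x \notin light k2.
Proof. by move=> e; rewrite inE /rank e -/(rank setT m) mtop -ltnNge. Qed.

Lemma Q_heavy x : x \in Q -> x \notin light k2.
Proof. by move=> /(subsetP Qtop); rewrite in_fiber => /andP[_ /eqP]; exact: m_heavy. Qed.

Lemma kernel2_light x : x \in light k2 -> fsize kernel2 kappa x = fsize setT kappa x.
Proof.
move=> xP; rewrite [RHS](saturated_fsize (P := light k2)) ?subsetT //; last exact: light_saturated.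
by rewrite (saturated_fsize (P := light k2)) ?subsetUl //; exact: light_saturated.
Qed.

Lemma kernel2_Q x : x \in Q -> fsize kernel2 kappa x = k2.
Proof.
move=> xQ; rewrite -Qcard; apply: eq_card => y; rewrite in_fiber in_setU.
have := subsetP Qtop x xQ; rewrite in_fiber => /andP[_ /eqP ->].
case yQ: (y \in Q); rewrite ?orbT /=.
  by have := subsetP Qtop y yQ; rewrite in_fiber => /andP[].
rewrite orbF; apply/negbTE/negP => /andP[yP /eqP/m_heavy]; by rewrite yP.
Qed.

Lemma light_fsize x : x \in light k2 -> fsize setT kappa x <= k2.
Proof. by rewrite inE rank_below; apply: leq_trans; rewrite leq_addl. Qed.

Lemma solvable_kernel2 :
  solvable setT k2 eta <-> solvable kernel2 k2 (eta - (fsize setT kappa m - k2)).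
Proof.
split=> [[phi0 sol0]|[phi0 sol0]].
  have [phi [cphi hc he] pre] := prefix_solution mono sol0.
  have AP := affected_light pre.
  have [psi [cpsi hc' e1 e2]] := transfer (subsetT _) (subsetUl (light k2) Q : light k2 \subset
    kernel2)
    (@light_saturated k2) cphi hc AP.
  have small x : x \in light k2 -> fsize setT phi x <= k2.
    move=> xP; case xA: (x \in affected setT phi); first exact: affected_fsize xA.
    by rewrite /fsize unaffected_fiber ?xA //; apply: light_fsize.
  have em : fsize setT phi m = fsize setT kappa m.
    by rewrite /fsize unaffected_fiber //; apply/negP => /(subsetP AP);
      rewrite (negbTE (m_heavy _)).
  have top x : x \in kernel2 -> fsize kernel2 psi x <= k2.
    move=> xK; case xP: (x \in light k2); first by rewrite e1 // small.
    by rewrite e2 ?xP // kernel2_Q //; move: xK; rewrite in_setU xP.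
  (* The subtraction in the new slack may truncate to 0; then balance with [m] would force a size
     above [k2], against [small]. *)
  have bot x : x \in kernel2 -> k2 <= fsize kernel2 psi x + (eta - (fsize setT kappa m - k2)).
    move=> xK; case xP: (x \in light k2); last first.
      by rewrite e2 ?xP // kernel2_Q ?leq_addr //; move: xK; rewrite in_setU xP.
    rewrite e1 //; have := he m x (in_setT m) (in_setT x); rewrite em.
    have := small x xP; move: (fsize setT phi x) mbig => u; clear; lia.
  by exists psi; split=> // x y xK yK; apply: leq_trans (top x xK) (bot y yK).
have monoK : size_monotone kernel2.
  move=> x y; case xP: (x \in light k2); case yP: (y \in light k2) => xK yK le.
  - by rewrite !kernel2_light //; apply: mono.
  - rewrite kernel2_light // [X in _ <= X]kernel2_Q ?light_fsize //.
    by move: yK; rewrite in_setU yP.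
  - move: xP; rewrite inE => /negP; case; move: yP; rewrite inE; apply: leq_trans.
    exact: rank_mono.
  - by rewrite !kernel2_Q //; move: xK yK; rewrite !in_setU xP yP.
have [phi [cphi hc he] pre] := prefix_solution monoK sol0.
have AP : affected kernel2 phi \subset light k2.
  apply/subsetP=> x xA; apply: contraT => xP.
  have xK : x \in kernel2 by move: xA; rewrite inE => /andP[].
  have xQ : x \in Q by move: xK; rewrite in_setU (negbTE xP).
  (* [Q] comes last in the order, so an affected vertex of [Q] gives [#|kernel2| <= k2]; but its
     group would have to exceed the [k2] vertices of [Q]. *)
  have rK : rank kernel2 x = #|kernel2|.
    apply: eq_card => y; rewrite !inE; have := subsetP Qtop x xQ.
    rewrite in_fiber => /andP[_ /eqP ->]; by rewrite rankT_max ?andbT.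
  have := pre x xA; rewrite rK => h.
  move: xA; rewrite inE xK kernel2_Q //= ltnNge => /negP; case.
  apply: leq_trans h; apply: subset_leq_card; apply/subsetP=> y.
  by rewrite in_fiber => /andP[].
have [psi [cpsi hc' e1 e2]] := transfer (subsetUl (light k2) Q : light k2 \subset kernel2)
  (subsetT _)
   (@light_saturated k2) cphi hc AP.
have small x : x \in light k2 -> fsize kernel2 phi x <= k2.
  move=> xP; have xK : x \in kernel2 by rewrite in_setU xP.
  case xA: (x \in affected kernel2 phi); first exact: affected_fsize xA.
  by rewrite /fsize unaffected_fiber ?xA // -/(fsize _ _ _) kernel2_light //; apply: light_fsize.
have top x : fsize setT psi x <= fsize setT kappa m.
  case xP: (x \in light k2); first by rewrite e1 // (leq_trans (small x xP)) // ltnW.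
  by rewrite e2 ?xP //; apply: mono => //; exact: rankT_max.
have bot x : fsize setT kappa m <= fsize setT psi x + eta.
  case xP: (x \in light k2).
    have xK : x \in kernel2 by rewrite in_setU xP.
    have kpos : 0 < k2 by move: xP; rewrite inE; apply: leq_trans; apply/card_gt0P; exists x;
      rewrite !inE leqnn.
    have [q qQ] : exists q, q \in Q by apply/card_gt0P; rewrite Qcard.
    have qK : q \in kernel2 by rewrite in_setU qQ orbT.
    have eq : fsize kernel2 phi q = k2.
      rewrite /fsize unaffected_fiber -/(fsize _ _ _) ?kernel2_Q //.
      by apply/negP => /(subsetP AP); rewrite (negbTE (Q_heavy qQ)).
    have := he q x qK xK; rewrite eq e1 //.
    have gx := @good x; have lx := light_fsize xP.
    (* In both cases the largest size is at most [eta + k2], by [good] or by [lx], so the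
       subtraction in the new slack is exact. *)
    have [h|h] := ltnP (fsize setT kappa x + eta) (fsize setT kappa m).
      have /andP[_] := gx h; move: (fsize kernel2 phi x) mbig => u; clear; lia.
    move: (fsize kernel2 phi x) mbig h lx => u; clear; lia.
  rewrite e2 ?xP //; rewrite leqNgt; apply/negP => /good /andP[h _].
  by rewrite inE h in xP.
by exists psi; split=> // x y _ _; apply: leq_trans (top x) (bot y).
Qed.

Lemma card_kernel2 : #|kernel2| <= 2 * k2.
Proof.
apply: leq_trans (leq_card_setU _ _) _.
by rewrite Qcard mul2n -addnn leq_add2r card_light.
Qed.

End Shrink.
End Kernel.
End Labellings.

(** * Cluster graphs as labellings *)

Section LabelGraphs.
Variable V : finType.
Implicit Types (e : rel V) (kappa phi : V -> nat) (F : {set {set V}}).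

Definition label_graph kappa : rel V := fun x y => (x != y) && (kappa x == kappa y).

Lemma label_graph_simple kappa : simple_graph (label_graph kappa).
Proof.
split=> [x y|x]; last by rewrite /label_graph eqxx.
by rewrite /label_graph eq_sym [kappa x == _]eq_sym.
Qed.

Lemma component_label e kappa x : e =2 label_graph kappa ->
  component e x = fiber setT kappa x.
Proof.
move=> ee; apply/setP=> y; rewrite !inE /=; apply/idP/eqP => [/connectP[p]|exy].
  elim: p x => [|z p IHp] x /=; first by move=> _ ->.
  rewrite ee => /andP[/andP[_ /eqP ->] pp]; exact: IHp.
have [->|ne] := eqVneq x y; first exact: connect0.
by apply: connect1; rewrite ee /label_graph ne exy eqxx.
Qed.

Lemma cluster_label e kappa : e =2 label_graph kappa -> cluster_graph e.
Proof.
move=> ee _ /imsetP[z _ ->] x y; rewrite !(component_label _ ee) !inE /=.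
by move=> /eqP ex /eqP ey ne; rewrite ee /label_graph ne ex ey eqxx.
Qed.

Lemma balanced_label e kappa eta : e =2 label_graph kappa ->
  balanced eta e <-> even setT eta kappa.
Proof.
move=> ee; split=> [bal x y _ _|ev _ _ /imsetP[x _ ->] /imsetP[y _ ->]].
  have := bal (component e x) (component e y) (imset_f _ isT) (imset_f _ isT).
  by rewrite !(component_label _ ee) -/(fsize _ _ _) -/(fsize _ _ _); lia.
rewrite !(component_label _ ee) -/(fsize _ _ _) -/(fsize _ _ _).
by have := ev x y (in_setT _) (in_setT _); have := ev y x (in_setT _) (in_setT _); lia.
Qed.

(** Double counting: an unordered pair [{a, b}] arises from exactly the ordered pairs [(a, b)] and
    [(b, a)]. *)
Lemma sum_pairs F : F \subset vertex_pairs V ->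
  \sum_x #|[set y | [set x; y] \in F]| = 2 * #|F|.
Proof.
move=> sF.
have -> : \sum_x #|[set y | [set x; y] \in F]| =
    \sum_(q : V * V | [set q.1; q.2] \in F) 1.
  rewrite -(pair_big_dep xpredT (fun x y => [set x; y] \in F) (fun _ _ => 1)) /=.
  by apply: eq_bigr => x _; rewrite -sum1_card; apply: eq_bigl => y; rewrite inE.
rewrite (partition_big (fun q : V * V => [set q.1; q.2]) (mem F)) //=.
rewrite mulnC -sum_nat_const; apply: eq_bigr => p pF.
have := subsetP sF p pF; rewrite inE => /cards2P[a [b [ab ep]]].
rewrite sum1dep_card (_ : [set _ | _] = [set (a, b); (b, a)]).
  by rewrite cards2 xpair_eqE (negbTE ab).
apply/setP=> -[x y]; rewrite !inE !xpair_eqE /=; apply/andP/idP => [[_ /eqP exy]|].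
  have : x \in p by rewrite -exy !inE eqxx.
  have : y \in p by rewrite -exy !inE eqxx orbT.
  have : b \in [set x; y] by rewrite exy ep !inE eqxx orbT.
  have : a \in [set x; y] by rewrite exy ep !inE eqxx.
  rewrite ep !inE; move: ab; do 2![case: eqVneq => ?]; subst; rewrite ?eqxx //=;
    do ?case: eqVneq => //= ?; subst; rewrite ?eqxx //=.
case/orP => /andP[/eqP -> /eqP ->]; last rewrite setUC; by rewrite -ep pF eqxx.
Qed.

(** Given [F], a vertex is labelled by the root of its component in the completed graph. Given a
    labelling, [F] consists of the pairs with equal new and different old labels. Every vertex gains
    as many group members as there are pairs of [F] through it, in total [2 * #|F|]. *)
Lemma yes_label e kappa k eta : e =2 label_graph kappa ->
  (exists F, [/\ F \subset vertex_pairs _ :\: edges e, #|F| <= k,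
     cluster_graph (add_edges e F) & balanced eta (add_edges e F)]) <->
  solvable kappa setT (2 * k) eta.
Proof.
move=> ee.
have sumT (f : V -> nat) : \sum_(x in [set: V]) f x = \sum_x f x.
  by apply: eq_bigl => x; rewrite in_setT.
split=> [[F [sF cF clF balF]]|[phi [cphi hc he]]].
  set e' := add_edges e F in clF balF.
  have sFv : F \subset vertex_pairs V.
    by apply: subset_trans sF _; apply: subsetDl.
  have sym : connect_sym e'.
    apply: sym_connect_sym => x y; rewrite /e' /add_edges !ee setUC.
    by rewrite (label_graph_simple kappa).1.
  pose phi x := val (enum_rank (fingraph.root e' x)).
  have phiE x y : (phi x == phi y) = connect e' x y.
    by rewrite /phi val_eqE (inj_eq enum_rank_inj) root_connect.
  have nF x : [set x; x] \notin F.
    by apply/negP => /(subsetP sFv); rewrite inE setUid cards1.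
  have e'E : e' =2 label_graph phi.
    move=> x y; rewrite /label_graph phiE.
    have [->|ne] /= := eqVneq x y.
      by rewrite /e' /add_edges ee /label_graph eqxx (negbTE (nF y)).
    apply/idP/idP => [/connect1 //|cxy].
    apply: (clF (component e' x)) ne; first exact: imset_f.
      by rewrite inE connect0.
    by rewrite inE.
  exists phi; split.
  - move=> x y _ _ exy; apply/eqP; rewrite phiE; have [->|ne] := eqVneq x y; first exact: connect0.
    by apply: connect1; rewrite /e' /add_edges ee /label_graph ne exy eqxx.
  - rewrite /cheap; apply: leq_trans (_ : \sum_(x in setT) fsize setT kappa x + 2 * #|F| <= _).
      rewrite -sum_pairs // !sumT -big_split /=; apply: leq_sum => x _.
      apply: leq_trans (leq_card_setU _ _); apply: subset_leq_card; apply/subsetP=> y.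
      rewrite !inE /= => exy; have [->|ne] := eqVneq y x; first by rewrite eqxx.
      have : e' x y by rewrite e'E /label_graph eq_sym ne eq_sym.
      rewrite /e' /add_edges ee /label_graph => /orP[/andP[_ /eqP ->]|->]; by rewrite ?eqxx ?orbT.
    by rewrite leq_add2l leq_mul2l cF.
  - exact/(balanced_label _ e'E).
pose F := [set p in vertex_pairs V |
  [exists x, exists y, [&& p == [set x; y], phi x == phi y & kappa x != kappa y]]].
have FE x y : ([set x; y] \in F) = (phi x == phi y) && (kappa x != kappa y).
  rewrite inE; apply/andP/andP => [[_ /existsP[a /existsP[b /and3P[/eqP eab pab kab]]]]|[pxy kxy]].
    have : a \in [set x; y] by rewrite eab !inE eqxx.
    have : b \in [set x; y] by rewrite eab !inE eqxx orbT.
    rewrite !inE => /orP[] /eqP eb /orP[] /eqP ea; subst; rewrite ?eqxx // in kab *.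
    by rewrite eq_sym pab eq_sym.
  split; last by apply/existsP; exists x; apply/existsP; exists y; rewrite eqxx pxy.
  by rewrite inE cards2; have [exy|//] := eqVneq x y; rewrite exy eqxx in kxy.
have e'E : add_edges e F =2 label_graph phi.
  move=> x y; rewrite /add_edges ee FE /label_graph.
  have [->|ne] /= := eqVneq x y; first by rewrite !eqxx.
  have [ek|nk] := eqVneq (kappa x) (kappa y); last by rewrite andbT.
  by rewrite (cphi x y) ?in_setT ?eqxx.
have sFv : F \subset vertex_pairs V by apply/subsetP=> p; rewrite inE => /andP[].
exists F; split; [| |exact: cluster_label e'E|exact/(balanced_label _ e'E)].
  apply/subsetP=> p pF; rewrite in_setD (subsetP sFv) // andbT.
  apply/negP; rewrite inE => /existsP[x /existsP[y /andP[exy /eqP ep]]].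
  by move: pF exy; rewrite ep FE ee => /andP[_ /negbTE h] /andP[_]; rewrite h.
rewrite -(leq_pmul2l (isT : 0 < 2)) -sum_pairs //.
move: hc; rewrite /cheap -(leq_add2l (\sum_(x in setT) fsize setT kappa x)) => hc.
rewrite -(leq_add2l (\sum_(x in setT) fsize setT kappa x)).
apply: leq_trans (_ : \sum_(x in setT) fsize setT phi x <= _); last first.
  by move: hc; rewrite leq_add2l.
rewrite !sumT -big_split /=; apply: leq_sum => x _.
rewrite -cardsUI [X in _ + X](_ : _ = 0); last first.
  apply/eqP; rewrite cards_eq0; apply/eqP/setP=> y; rewrite in_set0 inE in_fiber inE FE.
  by rewrite in_setT eq_sym /=; case: eqP; rewrite ?andbF.
rewrite addn0; apply: subset_leq_card; apply/subsetP=> y;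
  rewrite in_setU in_fiber inE FE in_fiber in_setT /=.
by case/orP => [/eqP e1|/andP[/eqP -> _]] //; apply/eqP/cphi.
Qed.

End LabelGraphs.

(** Instances live on ordinals, whereas the kernels are subsets of the vertex set; this renumbers
    the subset. *)
Lemma solvable_enum_val (V : finType) (kappa : V -> nat) (K : {set V}) k2 eta :
  solvable (fun i : 'I_#|K| => kappa (enum_val i)) setT k2 eta <-> solvable kappa K k2 eta.
Proof.
have fsE phi i : fsize setT (fun i : 'I_#|K| => phi (enum_val i)) i = fsize K phi (enum_val i).
  rewrite /fsize -(card_imset _ (@enum_val_inj _ (mem K))); apply: eq_card => y.
  rewrite in_fiber; apply/imsetP/andP => [[j]|[yK /eqP e]].
    by rewrite in_fiber => /andP[_ /eqP e] ->; rewrite e; split=> //; apply: enum_valP.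
  exists (enum_rank_in yK y); last by rewrite enum_rankK_in.
  by rewrite in_fiber in_setT enum_rankK_in //= e.
have sumE phi : \sum_(i in [set: 'I_#|K|]) fsize setT (fun i => phi (enum_val i)) i =
    \sum_(x in K) fsize K phi x.
  rewrite [RHS]big_enum_val; apply: eq_big => [i|i _]; by rewrite ?inE ?fsE.
have ex x : x \in K -> exists i : 'I_#|K|, x = enum_val i.
  by move=> xK; exists (enum_rank_in xK x); rewrite enum_rankK_in.
split=> [[phi' sol]|[phi [cphi hc he]]]; last first.
  exists (fun i => phi (enum_val i)); split.
  - by move=> i j _ _; apply: cphi; apply: enum_valP.
  - by rewrite /cheap !sumE.
  - by move=> i j _ _; rewrite !fsE; apply: he; apply: enum_valP.
(* Outside [K] the label is the dummy 0, where it is never read. *)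
pose phi x := if [pick i : 'I_#|K| | enum_val i == x] is Some i then phi' i else 0.
have phiE i : phi (enum_val i) = phi' i.
  by rewrite /phi; case: pickP => [j /eqP/enum_val_inj ->|/(_ i)]; rewrite ?eqxx.
have fsE' i : fsize setT phi' i = fsize setT (fun i : 'I_#|K| => phi (enum_val i)) i.
  by apply: eq_card => j; rewrite !in_fiber !phiE.
case: sol => cphi hc he; exists phi; split.
- move=> _ _ /ex[i ->] /ex[j ->] e; rewrite !phiE; exact: cphi.
- by move: hc; rewrite /cheap (eq_bigr _ (fun i _ => fsE' i)) !sumE.
- by move=> _ _ /ex[i ->] /ex[j ->]; rewrite -!fsE -!fsE'; apply: he.
Qed.

(** * The kernelization *)

(* All quantities are functions of natural numbers, computed from the memory
   contents [c], so that the program can refer to them directly. *)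
Definition adj (n : nat) (c : nat -> nat) (v u : nat) : bool :=
  (v == u) || (c (3 + v * n + u) != 0).

(* Orders the cliques by size; the largest index in the clique breaks ties. *)
Definition key (n : nat) (c : nat -> nat) (v : nat) : nat :=
  (\sum_(u < n) adj n c v u) * n + \max_(u < n | adj n c v u) u.

Section Quantities.
Variables (n : nat) (kappa : nat -> nat).

Definition count_lt v := \sum_(u < n) (kappa u < kappa v).
Definition count_le v := \sum_(u < n) (kappa u <= kappa v).
(** The position of [v] inside its clique, which selects the [k2] vertices to keep of a largest
    clique that is shrunk. *)
Definition count_prev v := \sum_(u < n) ((kappa u == kappa v) && (u < v)).
Definition max_size := \max_(v < n) (count_le v - count_lt v).

(** The situation of [too_small_unsolvable], tested only when the largest clique will be shrunk;
    otherwise the kernel retains the smallest heavy and the largest clique and decides balance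
    itself. *)
Definition bad (k2 eta v : nat) : bool :=
  [&& k2 < max_size, count_le v - count_lt v + eta < max_size &
      (k2 < count_le v) || (eta + k2 < max_size)].

Definition keep (k2 v : nat) : bool :=
  if k2 < max_size then (count_le v <= k2) || (count_le v == n) && (count_prev v < k2)
  else (count_lt v <= k2) || (count_le v == n).

End Quantities.

Definition label_instance (n : nat) (kappa : 'I_n -> nat) (k eta : nat) : bcc_instance :=
  @BCCInstance n (label_graph kappa) k eta (label_graph_simple kappa)
    (cluster_label (fun _ _ => erefl)).

(** An edge and an isolated vertex, with budget and slack 0. *)
Definition no_instance : bcc_instance :=
  label_instance (fun i : 'I_3 => nat_of_bool (i < 2)) 0 0.

Definition induced_instance (n : nat) (kappa : nat -> nat) (K : {set 'I_n}) (k eta : nat) :=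
  label_instance (fun i : 'I_#|K| => kappa (enum_val i)) k eta.

Definition word (I : bcc_instance) : nat -> nat := nth 0 (encode_bcc I).
Definition vkey (I : bcc_instance) : nat -> nat := key (nvert I) (word I).

(** One formula for the slack serves both cases, since the truncated difference [max_size - k2]
    vanishes when nothing is shrunk. *)
Definition kernel (I : bcc_instance) : bcc_instance :=
  let n := nvert I in let k2 := budget I + budget I in
  if n <= k2 then I
  else if has (bad n (vkey I) k2 (slack I)) (iota 0 n) then no_instance
  else induced_instance (vkey I) [set x : 'I_n | keep n (vkey I) k2 x]
         (budget I) (slack I - (max_size n (vkey I) - k2)).

(** * The input word, the keys and correctness of the kernel *)

Lemma nth_allpairs (S T U : Type) (g : S -> T -> U) (s : seq S) (t : seq T) x0 y0 z0 i j :
  i < size s -> j < size t ->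
  nth z0 [seq g x y | x <- s, y <- t] (i * size t + j) = g (nth x0 s i) (nth y0 t j).
Proof.
elim: s i => // x s IHs [|i] /= lt_i lt_j; rewrite nth_cat size_map.
  by rewrite lt_j (nth_map y0).
by rewrite mulSn -addnA ltnNge leq_addr /= addKn IHs.
Qed.

Lemma size_encode I : size (encode_bcc I) = 3 + nvert I * nvert I.
Proof. by rewrite /encode_bcc size_cat size_allpairs -!cardE card_ord. Qed.

Lemma word_graph I (x y : 'I_(nvert I)) : word I (3 + x * nvert I + y) = @graph I x y.
Proof.
rewrite /word /encode_bcc -addnA /= -[in X in x * X](size_enum_ord (nvert I)).
by rewrite (nth_allpairs _ x y) ?size_enum_ord // !nth_ord_enum. Qed.

Section InputInstance.
Variable I : bcc_instance.
Local Notation n := (nvert I).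
Local Notation kappa := (fun x : 'I_n => vkey I x).

(** In a cluster graph, adjacency completed by the diagonal is already connectivity. *)
Lemma adjE (x y : 'I_n) : adj n (word I) x y = connect (@graph I) x y.
Proof.
rewrite /adj word_graph eqb0 negbK; apply/idP/idP => [/orP[/eqP/val_inj ->|/connect1]|cxy] //.
have [->|ne] := eqVneq x y; first by rewrite eqxx.
apply/orP; right.
apply: (@graph_cluster I (component (@graph I) x)) ne; first exact: imset_f.
  by rewrite inE connect0.
by rewrite inE.
Qed.

Lemma graph_sym : connect_sym (@graph I).
Proof. by apply: sym_connect_sym; exact: (graph_simple I).1. Qed.

Let deg (x : 'I_n) := \sum_(u < n) adj n (word I) x u.
Let top (x : 'I_n) := \max_(u < n | adj n (word I) x u) u.

Lemma top_lt x : top x < n.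
Proof.
have n_gt0 : 0 < n by apply: leq_ltn_trans (ltn_ord x).
apply: leq_ltn_trans (_ : n.-1 < n); last by rewrite prednK.
by apply/bigmax_leqP => i _; rewrite -ltnS prednK.
Qed.

(** Equal keys have equal remainders modulo [n], that is, equal largest clique members, and this
    common vertex is connected to both. *)
Lemma vkey_eq (x y : 'I_n) : (vkey I x == vkey I y) = connect (@graph I) x y.
Proof.
apply/eqP/idP => [e|cxy]; last first.
  have eqa (u : 'I_n) : adj n (word I) x u = adj n (word I) y u.
    by rewrite !adjE; apply: same_connect cxy _; exact: graph_sym.
  by rewrite /vkey /key; congr (_ * _ + _); [apply: eq_bigr => u _ | apply: eq_bigl => u];
    rewrite eqa.
have et : top x = top y.
  have := congr1 (modn^~ n) e; rewrite /vkey /key -/(deg x) -/(deg y) -/(top x) -/(top y) /=.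
  by rewrite !modnMDl !modn_small ?top_lt.
have att (z : 'I_n) : exists2 u : 'I_n, connect (@graph I) z u & top z = u.
  have [|u] := @eq_bigmax_cond _ [pred u : 'I_n | adj n (word I) z u] (fun u => val u).
    by apply/card_gt0P; exists z; rewrite inE /= /adj eqxx.
  by rewrite inE adjE => cu e'; exists u => //; rewrite -e'.
have [u cu eu] := att x; have [w cw ew] := att y.
have uw : u = w by apply: val_inj; rewrite /= -eu -ew.
by apply: connect_trans cu _; rewrite graph_sym uw.
Qed.

Lemma graph_label : @graph I =2 label_graph kappa.
Proof.
move=> x y; rewrite /label_graph vkey_eq -adjE /adj word_graph eqb0 negbK.
have [->|ne] /= := eqVneq x y; first exact: (graph_simple I).2.
by rewrite val_eqE (negbTE ne).
Qed.

Lemma deg_fsize x : deg x = fsize setT kappa x.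
Proof.
rewrite /deg /fsize -sum1_card [RHS]big_mkcond; apply: eq_bigr => u _.
by rewrite in_fiber in_setT vkey_eq graph_sym adjE; case: connect.
Qed.

(** The clique size is the leading part of the key and the largest index, being below [n], its last
    digit in base [n]. *)
Lemma vkey_mono : size_monotone kappa setT.
Proof.
move=> x y _ _; rewrite -!deg_fsize /vkey /key -/(deg x) -/(deg y) -/(top x) -/(top y) => le.
have := top_lt y; rewrite leqNgt; move: (deg x) (deg y) (top x) (top y) le => a b c d le ld.
by apply/negP; nia.
Qed.

Lemma count_leE (x : 'I_n) : count_le n (vkey I) x = rank kappa setT x.
Proof. 
rewrite /count_le /rank -sum1_card [RHS]big_mkcond; apply: eq_bigr => u _.
by rewrite !inE; case: leq.
Qed.

Lemma count_ltE (x : 'I_n) : count_lt n (vkey I) x = below kappa x.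
Proof.
rewrite /count_lt /below -sum1_card [RHS]big_mkcond; apply: eq_bigr => u _.
by rewrite !inE; case: leq.
Qed.

Lemma sizeE (x : 'I_n) : count_le n (vkey I) x - count_lt n (vkey I) x = fsize setT kappa x.
Proof. by rewrite count_leE count_ltE rank_below addKn. Qed.

Lemma max_sizeE (m : 'I_n) : rank kappa setT m = n -> max_size n (vkey I) = fsize setT kappa m.
Proof.
move=> mtop; apply/eqP; rewrite eqn_leq; apply/andP; split.
  apply/bigmax_leqP => x _; rewrite sizeE; apply: vkey_mono; rewrite ?in_setT //.
  by apply: (@rankT_max _ kappa); rewrite card_ord.
rewrite -sizeE.
exact: (leq_bigmax (F := fun v : 'I_n => count_le n (vkey I) v - count_lt n (vkey I) v)).
Qed.

End InputInstance.

(** Taking the elements of [C] with fewer than [j] predecessors in [C] takes the first [j] of them.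
    It counts the vertices kept from the largest clique. *)
Lemma sum_first (C : pred nat) j n :
  \sum_(v < n) (C v && (\sum_(u < v) C u < j)) = minn j (\sum_(v < n) C v).
Proof.
elim: n => [|n IHn]; first by rewrite !big_ord0 minn0.
rewrite !big_ord_recr /= IHn; move: (\sum_(u < n) C u) => s.
by case: (C n) => /=; rewrite ?addn0 //; case: ltnP; lia.
Qed.

Lemma no_instance_no : ~ bcc_yes no_instance.
Proof.
move/(yes_label 0 0 (fun _ _ => erefl)) => [phi [cphi hc he]].
set kappa := (X in coarser X) in cphi hc.
have sz x : fsize setT phi x = fsize setT kappa x.
  rewrite /fsize (unaffected_fiber cphi) ?in_setT //.
  by have := card_affected cphi hc; rewrite leqn0 cards_eq0 => /eqP ->; rewrite in_set0.
have szE x : fsize setT kappa x = \sum_(y < 3) (kappa y == kappa x).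
  rewrite /fsize -sum1_card big_mkcond; apply: eq_bigr => y _.
  by rewrite in_fiber in_setT; case: eqP.
have := he (inord 0) (inord 2) (in_setT _) (in_setT _).
by rewrite !sz !szE !big_ord_recl !big_ord0 /kappa /= !inordK.
Qed.

Lemma kernel_correct (I : bcc_instance) :
  [/\ nvert (kernel I) <= 10 * budget I \/
        [/\ budget I = 0, ~ bcc_yes I & nvert (kernel I) <= 3],
      budget (kernel I) <= budget I &
      bcc_yes (kernel I) <-> bcc_yes I].
Proof.
have yesI : bcc_yes I <-> solvable (fun x : 'I_(nvert I) => vkey I x) setT (budget I + budget
  I) (slack I).
  by rewrite addnn -mul2n; apply: yes_label; exact: graph_label.
rewrite /kernel /=; set n := nvert I; set k2 := budget I + budget I in yesI *.
case: (leqP n k2) => [nk|large]; first by split; [left | by [] | by []]; move: nk;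
  rewrite /n /k2; clear; lia.
have mono := @vkey_mono I; set kappa := (fun x : 'I_n => vkey I x) in yesI mono *.
have large' : k2 < #|'I_n| by rewrite card_ord.
have [m] : exists m, rank kappa setT m = #|'I_n| by apply: (exists_top _ (Ordinal
  (leq_ltn_trans (leq0n k2) large))).
rewrite card_ord => mtop; have mtop' : rank kappa setT m = #|'I_n| by rewrite card_ord.
have hM := max_sizeE mtop.
case: ifPn => [/hasP[v]|/hasPn nobad].
  rewrite mem_iota add0n => /= vn; have [x ->] : exists x : 'I_n, v = x by exists (Ordinal vn).
  rewrite /bad hM sizeE count_leE => /and3P[_ h1 h2].
  have no : ~ bcc_yes I.
    by move/yesI; apply: (too_small_unsolvable mono large' mtop') h1 h2.
  split=> //; last by split=> // /no_instance_no.
  (* For positive [k] three vertices are within [10k]. *)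
  by have [->|pos] := posnP (budget I); [right | left; lia].
set K := [set x | _].
suff [cK sK] : #|K| <= 10 * budget I /\
    (solvable kappa K k2 (slack I - (max_size n (vkey I) - k2)) <-> solvable kappa setT k2
      (slack I)).
  split=> //; first by left.
  rewrite yesI -sK -solvable_enum_val /k2 addnn -mul2n; exact: yes_label.
have hk : 10 * budget I = 5 * k2 by rewrite /k2; lia.
rewrite hk; have [big|small] := ltnP k2 (max_size n (vkey I)); last first.
  have EK : K = kernel1 kappa k2.
    by apply/setP=> x; rewrite !inE /keep ltnNge small /= count_ltE count_leE card_ord.
  rewrite EK (eqP (_ : _ - k2 == 0)) ?subn_eq0 // subn0; split.
    apply: leq_trans (card_kernel1 _ mono mtop') _; rewrite hM in small.
    apply: leq_trans (_ : k2 + 2 * k2 <= _); first by rewrite leq_add2l leq_mul2l.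
    by clear; lia.
  by rewrite -(solvable_kernel1 _ mono large').
pose C := fiber setT kappa m.
pose Q := [set x in C | count_prev n (vkey I) x < k2].
have inC x : (x \in C) = (count_le n (vkey I) x == n).
  rewrite in_fiber in_setT /= count_leE; apply/eqP/eqP => [e|xt].
    by rewrite -mtop /rank /kappa (e : vkey I x = vkey I m).
  by apply/eqP; rewrite eqn_leq !(@rankT_max _ kappa) // card_ord.
have EK : K = kernel2 kappa k2 Q.
  apply/setP=> x; rewrite inE /keep big -inC count_leE in_setU.
  by congr (_ || _); rewrite [RHS]inE.
have cardQ : #|Q| = k2.
  pose P v := vkey I v == vkey I m.
  rewrite -sum1_card big_mkcond /=.
  transitivity (\sum_(v < n) (P v && (\sum_(u < v) P u < k2))).
    apply: eq_bigr => x _; rewrite inE in_fiber in_setT /= -/(P x).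
    case Px: (P x) => //=.
    suff -> : count_prev n (vkey I) x = \sum_(u < x) P u by case: ltnP.
    rewrite (big_ord_widen n (fun u => nat_of_bool (P u))); last exact: ltnW.
    rewrite [RHS]big_mkcond; apply: eq_bigr => u _.
    by rewrite /P -(eqP Px); case: (u < x); rewrite ?andbT ?andbF.
  rewrite sum_first; apply/minn_idPl; apply: ltnW; move: big; rewrite hM.
  rewrite /fsize -sum1_card big_mkcond => h; apply: leq_trans h _.
  by apply: leq_sum => x _; rewrite in_fiber in_setT /= /P; case: eqP.
have Qtop : Q \subset fiber setT kappa m by apply/subsetP=> x; rewrite inE => /andP[].
rewrite EK; split.
  by apply: leq_trans (card_kernel2 _ _) _; rewrite ?cardQ //; clear; lia.
rewrite hM in big *; rewrite -(solvable_kernel2 mono large' mtop' big Qtop cardQ) //.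
move=> x lt; have := nobad x; rewrite mem_iota add0n ltn_ord /bad hM big sizeE lt => /(_ isT) /=.
by rewrite count_leE negb_or -!leqNgt.
Qed.

(** * Symbolic execution *)

Definition env := seq (nat * nat).

Definition known (E : env) (r : nat) : bool := has (fun rv => eqn r rv.1) E.

Fixpoint get (E : env) (r : nat) : nat :=
  if E is rv :: E' then if eqn r rv.1 then rv.2 else get E' r else 0.

Definition holds (E : env) (c : nat -> nat) (s : state) : Prop :=
  (forall r, known E r -> regs s r = get E r) /\ cells s =1 c.

Definition included (E' E : env) : Prop :=
  all (fun rv => known E rv.1) E' /\ foldr (fun rv P => get E rv.1 = rv.2 /\ P) True E'.

(** The precondition fixes all known registers and the whole memory. Executed instructions are
    absorbed into [E] and [c], and the rest of the program waits inside [Q]; a triple for [PSkip] is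
    thus a symbolic state. *)
Definition hoare (n : nat) (E : env) (c : nat -> nat) (p : prog) (Q : state -> Prop) : Prop :=
  forall s, holds E c s -> Q (den n p s).

Lemma holds_included E' E c c' s :
  included E' E -> c =1 c' -> holds E c s -> holds E' c' s.
Proof.
move=> [kn ev] cc' [hr hc]; split=> [r|a]; last by rewrite hc.
elim: E' kn ev => //= -[r' v] E' IH /= /andP[kr kE] [<- ev].
have [->|ne] := eqVneq r r'; first by rewrite eqnE eqxx => _; apply: hr.
by rewrite eqnE (negbTE ne); apply: IH.
Qed.

Lemma holds_set_reg E c s r v : holds E c s -> holds ((r, v) :: E) c (set_reg s r v).
Proof.
by move=> [hr hc]; split=> // r' /=; rewrite eqnE /upd; case: eqP => //= _; exact: hr.
Qed.

Section Rules.
Variables (n : nat) (E : env) (c : nat -> nat).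
Implicit Types (Q : state -> Prop) (r a b : nat).

Lemma hoare_seq p q Q : hoare n E c p (fun s => Q (den n q s)) -> hoare n E c (PSeq p q) Q.
Proof. by []. Qed.

Lemma hoare_skip_seq q Q : hoare n E c q Q -> hoare n E c PSkip (fun s => Q (den n q s)).
Proof. by []. Qed.

Lemma hoare_post E' c' : included E' E -> c =1 c' -> hoare n E c PSkip (holds E' c').
Proof. by move=> iE cc' s; apply: holds_included. Qed.

Lemma hoare_const r v Q : hoare n ((r, v) :: E) c PSkip Q -> hoare n E c (PConst r v) Q.
Proof. by move=> h s hs; apply: h; apply: holds_set_reg. Qed.

Lemma hoare_add r a b Q : known E a -> known E b ->
  hoare n ((r, get E a + get E b) :: E) c PSkip Q -> hoare n E c (PAdd r a b) Q.
Proof. by move=> ka kb h s hs; apply: h; rewrite -!hs.1 //; apply: holds_set_reg. Qed.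

Lemma hoare_sub r a b Q : known E a -> known E b ->
  hoare n ((r, get E a - get E b) :: E) c PSkip Q -> hoare n E c (PSub r a b) Q.
Proof. by move=> ka kb h s hs; apply: h; rewrite -!hs.1 //; apply: holds_set_reg. Qed.

Lemma hoare_load r a Q : known E a ->
  hoare n ((r, c (get E a)) :: E) c PSkip Q -> hoare n E c (PLoad r a) Q.
Proof. by move=> ka h s hs; apply: h; rewrite -hs.1 // -hs.2; apply: holds_set_reg. Qed.

Lemma hoare_store r a Q : known E a -> known E r ->
  hoare n E (upd c (get E a) (get E r)) PSkip Q -> hoare n E c (PStore a r) Q.
Proof.
move=> ka kr h s hs; apply: h; split=> [r' kr'|b]; first by rewrite -hs.1.
by rewrite -!hs.1 //= /upd hs.2.
Qed.

Lemma hoare_if r p q Q : known E r ->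
  (get E r != 0 -> hoare n E c p Q) -> (get E r = 0 -> hoare n E c q Q) ->
  hoare n E c (PIf r p q) Q.
Proof.
move=> kr hp hq s hs /=; rewrite hs.1 //.
by have [e|ne] := eqVneq (get E r) 0; [apply: hq | apply: hp].
Qed.

(** The invariant consists of a register environment and a memory for each round. It must not
    mention the counters, which the loop itself overwrites; their values are supplied to the body
    and at the exit. *)
Lemma hoare_for (E' : nat -> env) (c' : nat -> nat -> nat) i d p Q :
  i != d -> (forall j, ~~ known (E' j) i && ~~ known (E' j) d) ->
  included (E' 0) E -> c =1 c' 0 ->
  (forall j, j < n ->
     hoare n ((i, j) :: (d, n - j) :: E' j) (c' j) p (holds (E' j.+1) (c' j.+1))) ->
  hoare n ((i, n) :: (d, 0) :: E' n) (c' n) PSkip Q ->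
  hoare n E c (PFor i d p) Q.
Proof.
move=> id fresh iE cc' hbody hQ s hs /=; apply: hQ.
have cnt j s1 : holds (E' j) (c' j) s1 ->
    holds ((i, j) :: (d, n - j) :: E' j) (c' j) (set_counter n i d j s1).
  move=> [hr hc]; split=> // r /=; rewrite /upd !eqnE.
  have [->|ri] := eqVneq r i; first by rewrite (negbTE id).
  by have [->|rd] //= := eqVneq r d; apply: hr.
rewrite -[X in (d, X)](subnn n).
apply: (iteri_inv (Q := fun j => holds ((i, j) :: (d, n - j) :: E' j) (c' j))).
  by apply: cnt; apply: holds_included hs.
by move=> j y jn hy; apply: cnt; apply: hbody.
Qed.

End Rules.

Ltac sym_step :=
  lazymatch goal with
  | |- hoare _ _ _ (PSeq _ _) _ => apply: hoare_seq
  | |- hoare _ _ _ PSkip (fun s => ?Q (den _ ?q s)) => apply: hoare_skip_seq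
  | |- hoare _ _ _ (PConst _ _) _ => apply: hoare_const
  | |- hoare _ _ _ (PAdd _ _ _) _ => apply: hoare_add; [reflexivity | reflexivity | ]
  | |- hoare _ _ _ (PSub _ _ _) _ => apply: hoare_sub; [reflexivity | reflexivity | ]
  | |- hoare _ _ _ (PLoad _ _) _ => apply: hoare_load; [reflexivity | ]
  | |- hoare _ _ _ (PStore _ _) _ => apply: hoare_store; [reflexivity | reflexivity | ]
  end; cbn [get eqn fst snd].

(** * The program *)

Notation rk := 3 (only parsing).
Notation reta := 4 (only parsing).
Notation rbase := 5 (only parsing).
Notation rv := 6 (only parsing).
Notation rv' := 7 (only parsing).
Notation ru := 8 (only parsing).
Notation ru' := 9 (only parsing).
Notation rp := 10 (only parsing).
Notation rx := 11 (only parsing).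
Notation rt := 12 (only parsing).
Notation racc := 13 (only parsing).
Notation rlast := 14 (only parsing).
Notation rq := 15 (only parsing).
Notation rkey := 16 (only parsing).
Notation rlt := 17 (only parsing).
Notation rle := 18 (only parsing).
Notation rprev := 19 (only parsing).
Notation rmax := 20 (only parsing).
Notation rbad := 21 (only parsing).
Notation rover := 22 (only parsing).
Notation rkeep := 23 (only parsing).
Notation ry := 24 (only parsing).
Notation rz := 25 (only parsing).

Declare Scope prog_scope.
Delimit Scope prog_scope with prog.
Local Notation "p ;; q" := (PSeq p q) (at level 90, right associativity) : prog_scope.
Local Notation PMov r a := (PAdd r a r0).
Local Notation PIncr r := (PAdd r r r1).

Definition std_env (n k2 eta base mx over bd : nat) : env :=
  [:: (r0, 0); (r1, 1); (rn, n); (rk, k2); (reta, eta); (rbase, base);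
      (rmax, mx); (rover, over); (rbad, bd)].

Ltac sym_run := unfold std_env; cbn [cat]; repeat sym_step.

Ltac sym_included :=
  split; [reflexivity | cbn [get eqn fst snd foldr std_env cat]; repeat split; try lia].

(** The first address after the input. There is no multiplication, so [n * n] is built by [n]
    additions. *)
Definition base_prog : prog :=
  (PConst rbase 3 ;; PFor rv rv' (PAdd rbase rbase rn))%prog.

Lemma base_spec n k2 eta c Q :
  hoare n (std_env n k2 eta (3 + n * n) 0 0 0) c PSkip Q ->
  hoare n (std_env n k2 eta 0 0 0 0) c base_prog Q.
Proof.
move=> h; rewrite /base_prog; sym_run.
apply: (@hoare_for _ _ _ (fun v => std_env n k2 eta (3 + v * n) 0 0 0) (fun=> c));
  [by [] | by [] | | by [] | |].
- by sym_included.
- by move=> v vn; sym_run; apply: hoare_post => //; sym_included.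
- move=> s hs; apply: h; apply: holds_included hs => //; sym_included.
Qed.

(** [1 - |v - u|], with the absolute value as a sum of two truncated differences, supplies the
    diagonal of [adj]. Every hit adds [n] to [racc], which yields the size times [n], and [rlast]
    ends as the largest hit because [u] increases. *)
Definition row_body : prog :=
  (PLoad rx rp ;; PIncr rp ;;
   PSub rt rv ru ;; PSub ry ru rv ;; PAdd rt rt ry ;; PSub rt r1 rt ;; PAdd rx rx rt ;;
   PIf rx (PAdd racc racc rn ;; PMov rlast ru) PSkip)%prog.

Definition keys_prog : prog :=
  (PConst rp 3 ;; PMov rq rbase ;;
   PFor rv rv'
     (PConst racc 0 ;; PConst rlast 0 ;; PFor ru ru' row_body ;;
      PAdd racc racc rlast ;; PStore rq racc ;; PIncr rq))%prog.

Definition write_at (a j : nat) (f c : nat -> nat) : nat -> nat :=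
  fun b => if (a <= b) && (b < a + j) then f (b - a) else c b.

Lemma write_at0 a f c : c =1 write_at a 0 f c.
Proof. by move=> b; rewrite /write_at addn0; case: leqP => //; case: ltnP => //; lia. Qed.

Lemma write_atS a j f c x : x = f j -> upd (write_at a j f c) (a + j) x =1 write_at a j.+1 f c.
Proof.
move=> -> b; rewrite /upd /write_at; case: eqP => [->|ne].
  by rewrite leq_addr addnS ltnS leqnn addKn.
by congr (if _ then _ else _); lia.
Qed.

Lemma keys_spec n k2 eta c Q (base := 3 + n * n) :
  hoare n (std_env n k2 eta base 0 0 0) (write_at base n (key n c) c) PSkip Q ->
  hoare n (std_env n k2 eta base 0 0 0) c keys_prog Q.
Proof.
move=> h; rewrite /keys_prog; sym_run.
apply: (@hoare_for _ _ _
  (fun v => std_env n k2 eta base 0 0 0 ++ [:: (rp, 3 + v * n); (rq, base + v)])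
  (fun v => write_at base v (key n c) c)); [by [] | by [] | | | |].
- by sym_included.
- exact: write_at0.
- move=> v vn; sym_run.
  apply: (@hoare_for _ _ _
    (fun u => std_env n k2 eta base 0 0 0 ++ [:: (rv, v); (rv', n - v); (rp, 3 + v * n + u);
      (rq, base + v); (racc, (\sum_(i < u) adj n c v i) * n);
      (rlast, \max_(i < u | adj n c v i) i)])
    (fun=> write_at base v (key n c) c)); [by [] | by [] | | by [] | |].
  + by sym_included; rewrite ?big_ord0.
  + move=> u un; rewrite /row_body; sym_run.
    (* The keys are stored behind the matrix and do not disturb it. *)
    have -> : write_at base v (key n c) c (3 + v * n + u) = c (3 + v * n + u).
      rewrite /write_at ifF //; apply/negbTE; rewrite negb_and -ltnNge; apply/orP; left.
      by rewrite /base; nia.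
    have test : (c (3 + v * n + u) + (1 - (v - u + (u - v))) != 0) = adj n c v u.
      by rewrite /adj; case: eqP => /=; lia.
    have maxS : \max_(i < u.+1 | adj n c v i) i =
        maxn (\max_(i < u | adj n c v i) i) (if adj n c v u then u else 0).
      by rewrite big_mkcond big_ord_recr /= -big_mkcond.
    have last_le : \max_(i < u | adj n c v i) i <= u.
      by apply/bigmax_leqP => i _; apply: ltnW.
    apply: hoare_if => //=; rewrite ?test => cond; sym_run; apply: hoare_post => //.
      sym_included; first by rewrite big_ord_recr /= cond; lia.
      by rewrite maxS cond addn0; apply/esym/maxn_idPr.
    have {}cond : adj n c v u = false by rewrite -test; apply/negbTE; rewrite cond.
    sym_included; first by rewrite big_ord_recr /= cond; lia.
    by rewrite maxS cond maxn0.
  + sym_run; apply: hoare_post; first by sym_included.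
    exact: write_atS.
- by move=> s hs; apply: h; apply: holds_included hs => //; sym_included.
Qed.

(** [ry], [rz] and [rt] are nonzero exactly if [u] lies in an earlier clique than [v], lies in a
    later clique, or has a smaller index, respectively. *)
Definition rank_body : prog :=
  (PAdd rt rbase ru ;; PLoad rx rt ;; PSub ry rkey rx ;; PSub rz rx rkey ;; PSub rt rv ru ;;
   PIf ry (PIncr rlt ;; PIncr rle)
     (PIf rz PSkip (PIncr rle ;; PIf rt (PIncr rprev) PSkip)))%prog.

Definition rank_prog : prog :=
  (PAdd rt rbase rv ;; PLoad rkey rt ;; PConst rlt 0 ;; PConst rle 0 ;; PConst rprev 0 ;;
   PFor ru ru' rank_body)%prog.

(** With truncated subtraction, [max(M, x) = M + (x - M)]. *)
Definition max_prog : prog :=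
  PFor rv rv' (rank_prog ;; PSub rx rle rlt ;; PSub rx rx rmax ;; PAdd rmax rmax rx)%prog.

(* When the tests are reached, [rover], [ry], [rx] and [rt] are nonzero exactly if the
   respective inequality [k2 < M], [size + eta < M], [k2 < count_le], [eta + k2 < M] holds. *)
Definition bad_prog : prog :=
  (PSub rx rle rlt ;; PSub rt rmax reta ;; PSub ry rt rx ;; PSub rt rt rk ;; PSub rx rle rk ;;
   PIf rover (PIf ry (PIf rx (PConst rbad 1) (PIf rt (PConst rbad 1) PSkip)) PSkip) PSkip)%prog.

(** [rz] is zero exactly for the largest clique, and [rt] is nonzero exactly if [v] is among the
    first [k2] vertices of its clique. *)
Definition keep_prog : prog :=
  (PConst rkeep 0 ;; PSub rx rle rk ;; PSub ry rlt rk ;; PSub rz rn rle ;; PSub rt rk rprev ;;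
   PIf rover
     (PIf rx (PIf rz PSkip (PIf rt (PConst rkeep 1) PSkip)) (PConst rkeep 1))
     (PIf ry (PIf rz PSkip (PConst rkeep 1)) (PConst rkeep 1)))%prog.

(** [rover] is [M - k2]: as a flag it tells whether the largest clique is shrunk, as a number it is
    what the slack loses. *)
Definition flags_prog : prog :=
  (PSub rover rmax rk ;;
   PFor rv rv'
     (rank_prog ;; bad_prog ;; keep_prog ;;
      PAdd rt rbase rn ;; PAdd rt rt rv ;; PStore rt rkeep))%prog.

Section Ranks.
Variables (n k2 eta base : nat) (kappa : nat -> nat).

Definition rank_env (mx over bd v : nat) : env :=
  std_env n k2 eta base mx over bd ++ [:: (rv, v); (rv', n - v);
    (rlt, count_lt n kappa v); (rle, count_le n kappa v); (rprev, count_prev n kappa v)].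

Lemma rank_spec mx over bd c v Q : v < n -> (forall u, u < n -> c (base + u) = kappa u) ->
  hoare n (rank_env mx over bd v) c PSkip Q ->
  hoare n ([:: (rv, v); (rv', n - v)] ++ std_env n k2 eta base mx over bd) c rank_prog Q.
Proof.
move=> vn keys h; rewrite /rank_prog; sym_run.
apply: (@hoare_for _ _ _
  (fun u => std_env n k2 eta base mx over bd ++ [:: (rv, v); (rv', n - v); (rkey, kappa v);
    (rlt, \sum_(i < u) (kappa i < kappa v)); (rle, \sum_(i < u) (kappa i <= kappa v));
    (rprev, \sum_(i < u) ((kappa i == kappa v) && (i < v)))])
  (fun=> c)); [by [] | by [] | | by [] | |].
- by sym_included; rewrite ?keys ?big_ord0.
- move=> u un; rewrite /rank_body; sym_run; rewrite keys //.
  apply: hoare_if => //; cbn [get eqn fst snd] => c1; sym_run.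
    apply: hoare_post => //; sym_included; rewrite big_ord_recr /=; lia.
  apply: hoare_if => //; cbn [get eqn fst snd] => c2; sym_run.
    by apply: hoare_post => //; sym_included; rewrite big_ord_recr /=; lia.
  apply: hoare_if => //; cbn [get eqn fst snd] => c3; sym_run.
    by apply: hoare_post => //; sym_included; rewrite big_ord_recr /=; lia.
  by apply: hoare_post => //; sym_included; rewrite big_ord_recr /=; lia.
- by move=> s hs; apply: h; apply: holds_included hs => //; sym_included.
Qed.

Lemma max_spec c Q : (forall u, u < n -> c (base + u) = kappa u) ->
  hoare n (std_env n k2 eta base (max_size n kappa) 0 0) c PSkip Q ->
  hoare n (std_env n k2 eta base 0 0 0) c max_prog Q.
Proof.
move=> keys h; rewrite /max_prog.
apply: (@hoare_for _ _ _
  (fun v => std_env n k2 eta base (\max_(i < v) (count_le n kappa i - count_lt n kappa i)) 0 0)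
  (fun=> c)); [by [] | by [] | | by [] | |].
- by sym_included; rewrite big_ord0.
- move=> v vn; apply: hoare_seq; apply: rank_spec => //; rewrite /rank_env; sym_run.
  by apply: hoare_post => //; sym_included; rewrite big_ord_recr /= maxnE.
- by move=> s hs; apply: h; apply: holds_included hs => //; sym_included.
Qed.

Local Notation M := (max_size n kappa).

Lemma count_le_max v : count_le n kappa v <= n.
Proof.
rewrite -[X in _ <= X]muln1 -[X in X * _](card_ord n) -sum_nat_const.
by apply: leq_sum => i _; exact: leq_b1.
Qed.

Lemma bad_spec bd c v Q :
  hoare n (rank_env M (M - k2) (bd || bad n kappa k2 eta v) v) c PSkip Q ->
  hoare n (rank_env M (M - k2) (bd : bool) v) c bad_prog Q.
Proof.
move=> h; rewrite /bad_prog /rank_env; sym_run.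
have fin (bd' : bool) E : bd' = bd || bad n kappa k2 eta v ->
    included (rank_env M (M - k2) bd' v) E -> hoare n E c PSkip Q.
  by move=> -> iE s hs; apply: h; apply: holds_included hs.
have leM := count_le_max v.
apply: hoare_if => //; cbn [get eqn fst snd] => c1; last first.
  apply: (fin bd); last by rewrite /rank_env; sym_included.
  by rewrite /bad -subn_gt0 c1 orbF.
have big : k2 < M by lia.
apply: hoare_if => //; cbn [get eqn fst snd] => c2; last first.
  apply: (fin bd); last by rewrite /rank_env; sym_included.
  by rewrite /bad big (_ : _ < M = false) ?orbF //; lia.
have small : count_le n kappa v - count_lt n kappa v + eta < M by lia.
apply: hoare_if => //; cbn [get eqn fst snd] => c3; sym_run.
  apply: (fin true); last by rewrite /rank_env; sym_included.
  by rewrite /bad big small; lia.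
apply: hoare_if => //; cbn [get eqn fst snd] => c4; sym_run.
  apply: (fin true); last by rewrite /rank_env; sym_included.
  by rewrite /bad big small; lia.
apply: (fin bd); last by rewrite /rank_env; sym_included.
by rewrite /bad big small; lia.
Qed.

Lemma keep_spec bd c v Q :
  hoare n ((rkeep, nat_of_bool (keep n kappa k2 v)) :: rank_env M (M - k2) bd v) c PSkip Q ->
  hoare n (rank_env M (M - k2) bd v) c keep_prog Q.
Proof.
move=> h; rewrite /keep_prog /rank_env; sym_run.
have fin (b : bool) E : b = keep n kappa k2 v ->
    included ((rkeep, nat_of_bool b) :: rank_env M (M - k2) bd v) E -> hoare n E c PSkip Q.
  by move=> -> iE s hs; apply: h; apply: holds_included hs.
have leM := count_le_max v.
have eqn_le : (count_le n kappa v == n) = (n - count_le n kappa v == 0).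
  by rewrite subn_eq0 eqn_leq leM.
apply: hoare_if => //; cbn [get eqn fst snd] => c1.
  have big : k2 < M by lia.
  apply: hoare_if => //; cbn [get eqn fst snd] => c2; last first.
    sym_run; apply: (fin true); last by rewrite /rank_env; sym_included.
    by rewrite /keep big; lia.
  apply: hoare_if => //; cbn [get eqn fst snd] => c3.
    sym_run; apply: (fin false); last by rewrite /rank_env; sym_included.
    by rewrite /keep big eqn_le; lia.
  apply: hoare_if => //; cbn [get eqn fst snd] => c4; sym_run.
    apply: (fin true); last by rewrite /rank_env; sym_included.
    by rewrite /keep big eqn_le; lia.
  apply: (fin false); last by rewrite /rank_env; sym_included.
  by rewrite /keep big eqn_le; lia.
have small : (k2 < M) = false by lia.
apply: hoare_if => //; cbn [get eqn fst snd] => c2; last first.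
  sym_run; apply: (fin true); last by rewrite /rank_env; sym_included.
  by rewrite /keep small; lia.
apply: hoare_if => //; cbn [get eqn fst snd] => c3; sym_run.
  apply: (fin false); last by rewrite /rank_env; sym_included.
  by rewrite /keep small eqn_le; lia.
apply: (fin true); last by rewrite /rank_env; sym_included.
by rewrite /keep small eqn_le; lia.
Qed.

Lemma flags_spec c Q : (forall u, u < n -> c (base + u) = kappa u) ->
  hoare n (std_env n k2 eta base M (M - k2) (has (bad n kappa k2 eta) (iota 0 n)))
    (write_at (base + n) n (fun v => nat_of_bool (keep n kappa k2 v)) c) PSkip Q ->
  hoare n (std_env n k2 eta base M 0 0) c flags_prog Q.
Proof.
move=> keys h; rewrite /flags_prog; sym_run.
apply: (@hoare_for _ _ _
  (fun v => std_env n k2 eta base M (M - k2) (has (bad n kappa k2 eta) (iota 0 v)))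
  (fun v => write_at (base + n) v (fun v => nat_of_bool (keep n kappa k2 v)) c));
  [by [] | by [] | | | |].
- by sym_included.
- exact: write_at0.
- move=> v vn; apply: hoare_seq; apply: rank_spec => //.
    by move=> u un; rewrite /write_at ifF ?keys //; apply/negbTE;
      rewrite negb_and -ltnNge ltn_add2l un.
  apply: hoare_skip_seq; apply: hoare_seq; apply: bad_spec.
  apply: hoare_skip_seq; apply: hoare_seq; apply: keep_spec; rewrite /rank_env; sym_run.
  apply: hoare_post; last exact: write_atS.
  sym_included.
  by rewrite -addn1 iotaD has_cat /= orbF.
- by move=> s hs; apply: h; apply: holds_included hs => //; sym_included.
Qed.

End Ranks.

(** The new matrix overwrites the old one from address 3 on. The budget stays in cell 1; the number
    of kept vertices and the new slack go to cells 0 and 2. *)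
Definition compact_prog : prog :=
  (PAdd rq rbase rn ;; PConst rp 3 ;; PConst racc 3 ;; PConst rlast 0 ;;
   PFor rv rv'
     (PAdd rt rq rv ;; PLoad rkeep rt ;; PAdd rlast rlast rkeep ;;
      PFor ru ru'
        (PLoad rx rp ;; PIncr rp ;; PAdd rt rq ru ;; PLoad ry rt ;;
         PIf rkeep (PIf ry (PStore racc rx ;; PIncr racc) PSkip) PSkip)) ;;
   PStore r0 rlast ;; PSub rx reta rover ;; PAdd rt r1 r1 ;; PStore rt rx)%prog.

Section Compact.
Variables (n k2 eta mx over bd : nat) (kp : nat -> bool) (c : nat -> nat).
Local Notation base := (3 + n * n).
Hypothesis flags : forall u, u < n -> c (base + n + u) = kp u.

Definition selected u := filter kp (iota 0 u).
Definition rows v := [seq c (3 + i * n + j) | i <- selected v, j <- selected n].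
Definition partial_rows v u :=
  rows v ++ (if kp v then [seq c (3 + v * n + j) | j <- selected u] else [::]).
Definition put_seq (w : seq nat) := write_at 3 (size w) (nth 0 w) c.

Lemma selectedS u : selected u.+1 = selected u ++ (if kp u then [:: u] else [::]).
Proof. by rewrite /selected -addn1 iotaD filter_cat. Qed.

Lemma size_selected u : size (selected u) <= u.
Proof. by rewrite size_filter (leq_trans (count_size _ _)) ?size_iota. Qed.

Lemma partial_rows0 v : partial_rows v 0 = rows v.
Proof. by rewrite /partial_rows /=; case: ifP; rewrite cats0. Qed.

Lemma partial_rowsn v : partial_rows v n = rows v.+1.
Proof.
rewrite /partial_rows /rows selectedS allpairs_cat; congr (_ ++ _).
by case: ifP => //= _; rewrite cats0.
Qed.

Lemma partial_rowsS v u : partial_rows v u.+1 =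
  if kp v && kp u then rcons (partial_rows v u) (c (3 + v * n + u)) else partial_rows v u.
Proof.
rewrite /partial_rows selectedS; case: (kp v) => //=; case: (kp u) => /=; last by rewrite cats0.
by rewrite map_cat /= catA cats1.
Qed.

(** The write position never overtakes the read position, so compaction in place destroys neither an
    unread entry nor a flag. *)
Lemma size_partial_rows v u : v < n -> u <= n -> size (partial_rows v u) <= v * n + u.
Proof.
move=> vn un; rewrite size_cat; apply: leq_add.
  by rewrite size_allpairs leq_mul // size_selected.
by case: ifP => // _; rewrite size_map size_selected.
Qed.

Lemma put_seq_out w a : 3 + size w <= a -> put_seq w a = c a.
Proof. by move=> h; rewrite /put_seq /write_at ifF //; apply/negbTE;
  rewrite negb_and -!leqNgt h orbT. Qed.

Lemma put_seq_rcons w x : upd (put_seq w) (3 + size w) x =1 put_seq (rcons w x).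
Proof.
move=> b; rewrite /upd /put_seq /write_at size_rcons.
case: eqP => [->|ne]; first by rewrite leq_addr addnS ltnS leqnn addKn nth_rcons ltnn eqxx.
rewrite nth_rcons addnS ltnS (leq_eqVlt b) (introF eqP ne) /=.
by case: ifP => // /andP[h1 h2]; rewrite ifT //; lia.
Qed.

Lemma compact_spec Q :
  hoare n (std_env n k2 eta base mx over bd)
    (upd (upd (put_seq (rows n)) 0 (size (selected n))) 2 (eta - over)) PSkip Q ->
  hoare n (std_env n k2 eta base mx over bd) c compact_prog Q.
Proof.
move=> h; rewrite /compact_prog; sym_run.
apply: (@hoare_for _ _ _
  (fun v => std_env n k2 eta base mx over bd ++ [:: (rq, base + n); (rp, 3 + v * n);
     (racc, 3 + size (rows v)); (rlast, size (selected v))])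
  (fun v => put_seq (rows v))); [by [] | by [] | | | |].
- by sym_included.
- exact: write_at0.
- move=> v vn; sym_run.
  have flagE w u : size w <= n * n -> u < n -> put_seq w (base + n + u) = kp u.
    by move=> sw un; rewrite put_seq_out ?flags //; lia.
  have szr : size (rows v) <= v * n by rewrite -partial_rows0 (leq_trans (size_partial_rows _
    _)) ?addn0.
  rewrite flagE //; last by apply: leq_trans szr _; rewrite leq_mul2r ltnW ?orbT.
  apply: (@hoare_for _ _ _
    (fun u => std_env n k2 eta base mx over bd ++ [:: (rv, v); (rv', n - v);
      (rkeep, nat_of_bool (kp v));
       (rq, base + n); (rp, 3 + v * n + u);
       (racc, 3 + size (partial_rows v u)); (rlast, size (selected v.+1))])
    (fun u => put_seq (partial_rows v u))); [by [] | by [] | | | |].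
  + sym_included; first by rewrite partial_rows0.
    by rewrite selectedS size_cat; case: (kp v).
  + by rewrite partial_rows0.
  + move=> u un; sym_run.
    have sz := size_partial_rows vn (ltnW un).
    rewrite flagE //; last by apply: leq_trans sz _; nia.
    rewrite put_seq_out; last by rewrite -addnA leq_add2l.
    have PS := partial_rowsS v u.
    apply: hoare_if => //; cbn [get eqn fst snd] => c1; last first.
      have kv : kp v = false by case: (kp v) c1.
      by apply: hoare_post; rewrite PS kv //; sym_included.
    apply: hoare_if => //; cbn [get eqn fst snd] => c2; last first.
      have ku : kp u = false by case: (kp u) c2.
      by apply: hoare_post; rewrite PS ku andbF //; sym_included.
    have kvu : kp v && kp u by case: (kp v) c1; case: (kp u) c2.
    sym_run; apply: hoare_post; rewrite PS kvu.
      by sym_included; rewrite size_rcons; lia.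
    exact: put_seq_rcons.
  + by rewrite partial_rowsn; apply: hoare_post => //; sym_included.
- sym_run => s hs; apply: h; apply: holds_included hs => //; sym_included.
Qed.

End Compact.

Fixpoint write_prog (a : nat) (w : seq nat) : prog :=
  if w is x :: w' then (PConst rt a ;; PConst rx x ;; PStore rt rx ;; write_prog a.+1 w')%prog
  else PSkip.

Lemma write_prog_cells n a w s b :
  cells (den n (write_prog a w) s) b = write_at a (size w) (nth 0 w) (cells s) b.
Proof.
elim: w a s => [|x w IHw] a s; first exact: write_at0.
rewrite [write_prog _ _]/= /den -/den IHw /write_at /= /upd /=.
have [->|ne] := eqVneq b a; first by rewrite ltnn leqnn addnS ltnS leq_addr subnn.
have -> : (a < b) && (b < a.+1 + size w) = (a <= b) && (b < a + (size w).+1) by lia.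
case: ifP => // /andP[le _]; have -> : b - a = (b - a.+1).+1 by lia.
by [].
Qed.

Definition no_word : seq nat := [:: 3; 0; 0; 0; 1; 0; 1; 0; 0; 0; 0; 0].

Lemma encode_no_instance : encode_bcc no_instance = no_word.
Proof.
rewrite /encode_bcc /= !enum_ordSl.
have -> : enum 'I_0 = [::] by apply: size0nil; rewrite size_enum_ord.
by [].
Qed.

Definition main_prog : prog :=
  (base_prog ;; keys_prog ;; max_prog ;; flags_prog ;;
   PIf rbad (write_prog 0 no_word) compact_prog)%prog.

Lemma map_enum_val (T : finType) (A : {set T}) :
  [seq enum_val i | i <- enum 'I_#|A|] = enum A.
Proof.
have [->|[x xA]] := set_0Vmem A.
  by rewrite enum_set0; apply: size0nil; rewrite size_map size_enum_ord cards0.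
apply: (@eq_from_nth _ x) => [|i]; first by rewrite size_map size_enum_ord cardE.
rewrite size_map size_enum_ord => lt_i.
rewrite (nth_map (Ordinal lt_i)) ?size_enum_ord // (enum_val_nth x).
by rewrite (nth_ord_enum _ (Ordinal lt_i)).
Qed.

(** Vertices of the kernel are enumerated in increasing order, so its adjacency matrix is the input
    matrix with the other rows and columns deleted. *)
Lemma encode_induced (I : bcc_instance) (kp : nat -> bool) k eta :
  encode_bcc (induced_instance (vkey I) [set x : 'I_(nvert I) | kp x] k eta) =
  [:: size (selected kp (nvert I)); k; eta] ++ rows (nvert I) kp (word I) (nvert I).
Proof.
set K := [set x | _].
have selE : [seq val x | x <- enum K] = selected kp (nvert I).
  rewrite /selected -val_enum_ord filter_map /K {1}/enum_mem; congr map.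
  by rewrite -enumT; apply: eq_filter => x; rewrite /= inE.
rewrite /encode_bcc /= /rows -selE size_map -cardE; congr [:: _, _, _ & _].
rewrite [RHS]allpairs_mapl [RHS]allpairs_mapr -map_enum_val [RHS]allpairs_mapl [RHS]allpairs_mapr.
apply: eq_allpairs => i j; rewrite -/(word I) word_graph graph_label /label_graph.
by rewrite (inj_eq enum_val_inj).
Qed.

Lemma main_spec (I : bcc_instance) (k2 := budget I + budget I) :
  k2 < nvert I ->
  hoare (nvert I) (std_env (nvert I) k2 (slack I) 0 0 0 0) (word I) main_prog
    (fun s => forall i, i < size (encode_bcc (kernel I)) ->
       cells s i = nth 0 (encode_bcc (kernel I)) i).
Proof.
move=> large; rewrite /kernel -/k2 [nvert I <= _]leqNgt large [if ~~ true then _ else _]/=.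
set Q := (X in hoare _ _ _ _ X); set n := nvert I.
rewrite /main_prog; apply: hoare_seq; apply: base_spec.
apply: hoare_skip_seq; apply: hoare_seq; apply: keys_spec.
have keys u : u < n -> write_at (3 + n * n) n (key n (word I)) (word I) (3 + n * n + u) = vkey I u.
  by move=> un; rewrite /write_at leq_addr ltn_add2l un addKn.
apply: hoare_skip_seq; apply: hoare_seq; apply: (max_spec keys).
apply: hoare_skip_seq; apply: hoare_seq; apply: (flags_spec keys).
apply: hoare_skip_seq; set c := write_at _ _ _ _.
rewrite /Q -/n.
apply: hoare_if => //; cbn [std_env get eqn fst snd].
  case: (has _ _) => // _ s _ i; rewrite encode_no_instance write_prog_cells => lt_i.
  by rewrite /write_at add0n lt_i subn0.
case: (has _ _) => // _; set kp := keep n (vkey I) k2.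
apply: (@compact_spec _ _ _ _ _ _ kp).
  by move=> u un; rewrite /c /write_at leq_addr ltn_add2l un addKn.
(* Keys and flags lie behind the input, so compaction still finds the original matrix. *)
have inp a : a < 3 + n * n -> c a = word I a.
  by move=> lt_a; rewrite /c /write_at !ifF //; lia.
move=> s [_ hc] i; rewrite encode_induced -/n -/kp.
have -> : rows n kp (word I) n = rows n kp c n.
  rewrite /rows; apply/eq_in_allpairs => x y;
    rewrite !mem_filter !mem_iota => /andP[_ xn] /andP[_ yn].
  by rewrite inp //; nia.
rewrite hc /upd size_cat /= => lt_i.
case: i lt_i => [|[|[|i]]] //= lt_i.
by rewrite /put_seq /write_at !subSS subn0 ifT //; lia.
Qed.

(** * The complete machine program and its polynomial running time *)

(** It establishes the register values that [den_runs] presupposes, hence is loop-free and timed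
    instruction by instruction. [rt] ends nonzero exactly if the number of vertices exceeds [k2]. *)
Definition prologue : prog :=
  (PConst r1 1 ;; PLoad rn r0 ;; PLoad rk r1 ;; PAdd rk rk rk ;;
   PAdd rt r1 r1 ;; PLoad reta rt ;; PSub rt rn rk)%prog.

Definition kernel_cmd : cmd :=
  CSeq (compile prologue) (CIf rt (compile main_prog) CSkip).

Lemma prologue_runs s : runs (compile prologue) s 8 (den 0 prologue s).
Proof.
apply: (runs_Seq (@runs_Const _ _ 1)); apply: (runs_Seq (@runs_Load _ _ _)).
apply: (runs_Seq (@runs_Load _ _ _)); apply: (runs_Seq (@runs_Add _ _ _ _)).
apply: (runs_Seq (@runs_Add _ _ _ _)); apply: (runs_Seq (@runs_Load _ _ _)).
exact: runs_Sub.
Qed.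

Lemma prologue_spec (I : bcc_instance) (k2 := budget I + budget I) :
  holds ((rt, nvert I - k2) :: std_env (nvert I) k2 (slack I) 0 0 0 0) (word I)
    (den 0 prologue (init_state (encode_bcc I))).
Proof.
pose E : env := [seq (r, 0) | r <- [:: r0; rbase; rmax; rover; rbad]].
have : hoare 0 E (word I) prologue
    (holds ((rt, nvert I - k2) :: std_env (nvert I) k2 (slack I) 0 0 0 0) (word I)).
  by rewrite /prologue /E; cbn [map]; sym_run; apply: hoare_post => //; sym_included.
apply; split=> // r _ /=.
by do ?case: ifP.
Qed.

Lemma nvert_kernel (I : bcc_instance) : nvert (kernel I) <= nvert I + 3.
Proof.
rewrite /kernel; case: ifP => _; first exact: leq_addr.
case: ifP => _ /=; first exact: leq_addl.
by apply: leq_trans (max_card _) _; rewrite card_ord leq_addr.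
Qed.

Lemma kernel_runs (I : bcc_instance) : exists2 s,
  runs kernel_cmd (init_state (encode_bcc I)) (10 + time (nvert I) main_prog) s &
  forall i, i < size (encode_bcc (kernel I)) -> cells s i = nth 0 (encode_bcc (kernel I)) i.
Proof.
set k2 := budget I + budget I.
have hs := prologue_spec I; set s1 := den 0 prologue _ in hs.
have et : regs s1 rt = nvert I - k2 by apply: hs.1.
have seq t s : runs (CIf rt (compile main_prog) CSkip) s1 t.+1 s -> t <= (time (nvert I)
  main_prog).+1 ->
    runs kernel_cmd (init_state (encode_bcc I)) (10 + time (nvert I) main_prog) s.
  move=> h le; apply: (runsW _ (runs_Seq (@prologue_runs _) h)); lia.
have [small|large] := leqP (nvert I) k2.
  (* Memory has not been written to, so the input stands there as the output. *)
  exists s1; last by rewrite /kernel small => i _; apply: hs.2.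
  apply: (seq 1) => //; apply: runs_If; rewrite et.
  by move: small; rewrite -subn_eq0 => ->; exact: runs_Skip.
have hE : holds (std_env (nvert I) k2 (slack I) 0 0 0 0) (word I) s1.
  by apply: holds_included hs => //; sym_included.
exists (den (nvert I) main_prog s1); last exact: (main_spec large hE).
apply: (seq (time (nvert I) main_prog)); last exact: leqnSn.
apply: runs_If; rewrite et -lt0n subn_gt0 large.
by apply: den_runs => //; apply: hE.1.
Qed.

(** The bit size of the whole input bounds the length of each of its numbers, which gives the
    initial exponent. *)
Lemma bounded_init w : bounded (bitsize w) (init_state w).
Proof.
split=> [r|a] //=.
have [lt|ge] := ltnP a (size w); last by rewrite nth_default.
apply: leq_trans (_ : 2 ^ bitlen (nth 0 w a) <= _).
  by apply: ltnW; apply: trunc_log_ltn.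
rewrite leq_exp2l // /bitsize (big_rem (nth 0 w a)) ?mem_nth //=; exact: leq_addr.
Qed.

Lemma size_bitsize w : size w <= bitsize w.
Proof. by rewrite -sum1_size; apply: leq_sum. Qed.

Lemma bitsize_le b w : (forall i, i < size w -> nth 0 w i <= 2 ^ b) -> bitsize w <= size w * b.+1.
Proof.
move=> h; rewrite /bitsize big_seq; apply: leq_trans (_ : \sum_(x <- w | x \in w) b.+1 <= _).
  apply: leq_sum => x /(nthP 0)[i lt_i <-]; apply: bitlen_le; exact: h.
by rewrite -big_seq big_const_seq count_predT iter_addn_0 mulnC.
Qed.

Lemma kernel_polytime : polytime encode_bcc encode_bcc kernel.
Proof.
have [A [d ht]] := time_poly main_prog.
(* With [D = L ^ d.+2] there are at most [(A + 10) * D] instructions, at most [19 * D] output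
   numbers, and at most [(A + 12) * D] bits in any number handled. The cost is a product of two such
   quantities, whence the doubled exponent. *)
exists kernel_cmd, ((3 * (A + 10) + 19) * (A + 12)), (2 * d.+2) => I.
set L := bitsize (encode_bcc I); set n := nvert I.
have [s hrun hout] := kernel_runs I.
set t := 10 + _ in hrun; have [c [ec hc [_ bs]]] := hrun L (bounded_init _).
have nL : n.+1 <= L.
  by apply: leq_trans (size_bitsize _); rewrite size_encode -/n; nia.
have L0 : 0 < L by apply: leq_trans nL.
set D := L ^ d.+2.
have LD : L * L <= D by rewrite /D 2!expnS mulnA leq_pmulr // expn_gt0 L0.
have tD : t <= (A + 10) * D.
  have le1 : n.+1 ^ d <= D.
    apply: leq_trans (_ : L ^ d <= _); first by case: (d) => // d'; rewrite leq_exp2r.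
    by apply: leq_pexp2l => //; rewrite -addn2 leq_addr.
  have := ht n; rewrite /t; move: le1; move: (n.+1 ^ d) (time _ _) => u w; clear -L0 LD; nia.
exists c, s; split=> //.
have bout : bitsize (encode_bcc (kernel I)) <= size (encode_bcc (kernel I)) * (L + t).+1.
  by apply: bitsize_le => i lt_i; rewrite -hout.
have szout : size (encode_bcc (kernel I)) <= 19 * D.
  rewrite size_encode; have := nvert_kernel I; rewrite -/n => le; nia.
have h2 : (L + t).+1 <= (A + 12) * D by nia.
apply: leq_trans (leq_addr _ _).
rewrite mul2n -addnn expnD -/D.
apply: leq_trans (_ : (3 * t + 19 * D) * (L + t).+1 <= _).
  rewrite mulnDl leq_add //; apply: leq_trans bout _; by rewrite leq_mul2r szout orbT.
rewrite mulnACA leq_mul //; nia.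
Qed.

(* If budget I = 0, the bound 10 * budget I only allows the empty graph, which
   is always a yes-instance; no-instances with budget 0 are therefore allowed
   to be mapped to a no-instance with at most 3 vertices. *)
Theorem mainTheorem1 :
  exists f : bcc_instance -> bcc_instance,
    polytime encode_bcc encode_bcc f /\
    forall I : bcc_instance,
      [/\ nvert (f I) <= 10 * budget I \/
            [/\ budget I = 0, ~ bcc_yes I & nvert (f I) <= 3],
          budget (f I) <= budget I &
          bcc_yes (f I) <-> bcc_yes I].
Proof. by exists kernel; split; [exact: kernel_polytime | exact: kernel_correct]. Qed.
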